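(* Let $(M,\eta,\omega)$ be a compact connected cosymplectic manifold of dimension $2n+1$. Let $\Phi_F=\{\phi_F^t\}$ be a co-Hamiltonian isotopy such that $\int_MF_t\,\eta\wedge\omega^n=0$ for all $t$. Then there exists a positive constant $C$, which depends only on $F$ and $\eta$, so that for any given positive real number $\epsilon$ one can find a co-Hamiltonian isotopy $\Phi_H=\{\phi_H^t\}$ such that 1. $\Phi_H$ is boundary flat, 2. $\int_MH_t\,\eta\wedge\omega^n=0$ for all $t$, 3. $\phi_H^0=\phi_F^0$ and $\phi_H^1=\phi_F^1$, 4. $D_{CH}^\infty(\Phi_F,\Phi_H)<2D_{CH}^\infty(\Phi_F,Id)+C\epsilon$, 5. in particular, $D_{CH}^\infty(\Phi_H,Id)<3D_{CH}^\infty(\Phi_F,Id)+C\epsilon$, 6. the $C^0$-distance $\bar d(\Phi_F,\Phi_H)$ can be made as small as we want (i.e. for every prescribed $\epsilon'>0$, $\Phi_H$ can be chosen so that in addition $\bar d(\Phi_F,\Phi_H)<\epsilon'$), where $Id:t\mapsto id_M$ is the constant path identity.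
   Context: A cosymplectic structure on a smooth manifold $M$ is a pair $(\eta,\omega)$ of a closed $1$-form $\eta$ and a closed $2$-form $\omega$ such that for each $x\in M$ the linear map $T_xM\to T_x^\ast M$, $Y\mapsto \iota(Y)\omega_x+\eta_x(Y)\eta_x$ is a bijection; then $\dim M=2n+1$ and $M$ is oriented by the volume form $\eta\wedge\omega^n$. For a vector field $X$ put $I_{\eta,\omega}(X):=\iota(X)\omega+\eta(X)\eta$. A cosymplectic isotopy is a smooth isotopy $\Phi=\{\phi_t\}_{t\in[0,1]}$ of $M$, $\phi_0=id_M$, with $\phi_t^\ast\eta=\eta$ and $\phi_t^\ast\omega=\omega$ for each $t$; $\dot\phi_t$ denotes the vector field $\frac{d\phi_t}{dt}\circ\phi_t^{-1}$. It is co-Hamiltonian if $I_{\eta,\omega}(\dot\phi_t)$ is exact for each $t$; one writes $\Phi_F$ when $I_{\eta,\omega}(\dot\phi_t)=dF_t$ with $F:(t,x)\mapsto F_t(x)$ a smooth function on $[0,1]\times M$. The constant path $Id$ is generated by the zero function. A co-Hamiltonian isotopy $\Phi_F$ is boundary flat if there exists $\delta\in\,]0,1[$ such that $F_t=0$ for all $t\in[0,\delta[\,\cup\,]1-\delta,1]$. $C(\Phi,\eta)^t$ denotes the function $x\mapsto\eta(\dot\phi_t)(\phi_t(x))$; for cosymplectic isotopies it is constant on $M$ for each $t$ and is identified with its constant value. For a function $f$ on $M$, $osc(f)=\max_Mf-\min_Mf$. For co-Hamiltonian isotopies $\Phi_F,\Psi_H$, $$D_{CH}^{\infty}(\Phi_F,\Psi_H)=\max_{t\in[0,1]}\left(osc(F_t-H_t)+|C(\Phi_F,\eta)^t-C(\Psi_H,\eta)^t|\right).$$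 With $d$ the distance on $M$ (induced by a fixed Riemannian metric), for homeomorphisms $f,h$ of $M$ put $d_{C^0}(f,h)=\sup_{x\in M}d(f(x),h(x))$ and $d_0(f,h)=\max(d_{C^0}(f,h),d_{C^0}(f^{-1},h^{-1}))$; for continuous paths $\lambda,\mu$ of homeomorphisms starting at $id_M$, $\bar d(\lambda,\mu)=\max_{t\in[0,1]}d_0(\lambda(t),\mu(t))$. *)

(* Defs.v *)
From HB Require Import structures.
From mathcomp Require Import all_boot all_order all_algebra all_fingroup.
From mathcomp Require Import all_classical all_reals all_analysis.
Set Implicit Arguments.
Unset Strict Implicit.
Unset Printing Implicit Defensive.
Import Order.TTheory GRing.Theory Num.Theory.
Import numFieldNormedType.Exports.
Local Open Scope classical_set_scope.
Local Open Scope ring_scope.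

Definition I01 (R : realType) : set R := `[0, 1]%classic.
Arguments I01 R : clear implicits.

Section SmoothMaps.
Context {R : realType} {V W : normedModType R}.

(* All iterated directional derivatives exist on U and are differentiable
   there; in finite dimension this is C^oo on the open set U. *)
Definition open_smooth (U : set V) (f : V -> W) :=
  forall (vs : seq V) (x : V), U x ->
    differentiable (foldr (fun v (h : V -> W) => 'D_v h) f vs) x.

(* On an arbitrary set: local existence of smooth extensions.  This is what
   smoothness on [0, 1] or on [0, 1] x U means, the endpoints included. *)
Definition smooth_on (A : set V) (f : V -> W) :=
  forall x, A x -> exists (U : set V) (h : V -> W),
    [/\ open U, U x, open_smooth U h & {in A `&` U, f =1 h}].

End SmoothMaps.

Record chart (R : realType) (T : topologicalType) (m : nat) := Chart {
  cdom : set T ;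
  coord : T -> 'rV[R]_m ;
  param : 'rV[R]_m -> T }.

Definition cimg R T m (c : @chart R T m) : set 'rV[R]_m := coord c @` cdom c.

Record is_chart R T m (c : @chart R T m) : Prop := IsChart {
  cdom_open : open (cdom c) ;
  cimg_open : open (cimg c) ;
  coordK : {in cdom c, cancel (coord c) (param c)} ;
  coord_continuous : {within cdom c, continuous (coord c)} ;
  param_continuous : {within cimg c, continuous (param c)} }.

(* Smooth manifolds without boundary.  The preferred chart [chart_at x] at
   each point identifies the tangent space at x with 'rV[R]_m, so that a
   tangent vector at x is a row vector, its coordinate expression in that
   chart.  The Jacobian [to_pref c z] converts coordinates in another chart c
   into coordinates in the preferred one. *)
Record manifold (R : realType) (m : nat) := Manifold {
  carrier :> topologicalType ;
  atlas : set (chart R carrier m) ;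
  chart_at : carrier -> chart R carrier m ;
  manifold_hausdorff : hausdorff_space carrier ;
  manifold_second_countable : @second_countable carrier ;
  atlas_chart : forall c, atlas c -> is_chart c ;
  atlas_compatible : forall c c', atlas c -> atlas c' ->
    smooth_on (coord c @` (cdom c `&` cdom c')) (coord c' \o param c) ;
  chart_at_atlas : forall x, atlas (chart_at x) ;
  chart_at_dom : forall x, cdom (chart_at x) x }.

Section Geometry.
Context {R : realType} {m : nat} {M : manifold R m}.
Implicit Types (c : chart R M m) (x y : M) (f : M -> M) (t : R).

Definition smooth_fun (u : M -> R) :=
  forall c, atlas c -> smooth_on (cimg c) (u \o param c).

Definition smooth_into (V : normedModType R) (A : set V) (h : V -> M) :=
  {within A, continuous h} /\
  forall c, atlas c -> smooth_on (A `&` h @^-1` cdom c) (coord c \o h).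

Definition smooth_map f :=
  forall c, atlas c -> smooth_into (cimg c) (f \o param c).

Definition smooth_fun_path (F : R -> M -> R) :=
  forall c, atlas c ->
    smooth_on (I01 R `*` cimg c) (fun p : R * 'rV[R]_m => F p.1 (param c p.2)).

Definition smooth_map_path (phi : R -> M -> M) :=
  forall c, atlas c ->
    smooth_into (I01 R `*` cimg c)
      (fun p : R * 'rV[R]_m => phi p.1 (param c p.2)).

Definition to_pref c (z : 'rV[R]_m) : 'M[R]_m :=
  'J (coord (chart_at (param c z)) \o param c) z.

Definition tangent_map f x : 'M[R]_m :=
  'J (coord (chart_at (f x)) \o f \o param (chart_at x))
     (coord (chart_at x) x).

(* Derivative relative to [0, 1]: one-sided at the endpoints. *)
Definition deriv01 (h : R -> 'rV[R]_m) t : 'rV[R]_m :=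
  lim ((s - t)^-1 *: (h s - h t) @[s --> within (I01 R) t^']).

(* Velocity at time t of a curve, a tangent vector at [gam t]. *)
Definition velocity (gam : R -> M) t : 'rV[R]_m :=
  deriv01 (coord (chart_at (gam t)) \o gam) t.

(* The k arguments of a k-form are the rows of a k x m matrix. *)
Definition dform (k : nat) := M -> 'M[R]_(k, m) -> R.

Definition local_form k (a : dform k) c (z : 'rV[R]_m) (A : 'M[R]_(k, m)) : R :=
  a (param c z) (A *m to_pref c z).

Record is_form k (a : dform k) : Prop := IsForm {
  form_multilinear : forall x (A B C : 'M[R]_(k, m)) i (b d : R),
    row i A = b *: row i B + d *: row i C ->
    row' i B = row' i A -> row' i C = row' i A ->
    a x A = b * a x B + d * a x C ;
  form_alternate : forall x (A : 'M[R]_(k, m)) i j,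
    i != j -> A i =1 A j -> a x A = 0 ;
  form_smooth : forall c, atlas c -> forall A : 'M[R]_(k, m),
    smooth_on (cimg c) (fun z => local_form a c z A) }.

(* Exterior derivative in the chart c, on constant coordinate vector fields. *)
Definition local_d k (a : dform k) c (z : 'rV[R]_m) (A : 'M[R]_(k.+1, m)) : R :=
  \sum_(i < k.+1)
    (-1) ^+ i * 'D_(row i A) (fun z' => local_form a c z' (row' i A)) z.

Definition closed_form k (a : dform k) :=
  forall c, atlas c -> forall z, cimg c z -> forall A, local_d a c z A = 0.

Definition wedge k l (a : dform k) (b : dform l) : dform (k + l) := fun x A =>
  (k`! * l`!)%:R^-1 *
  \sum_(s : 'S_(k + l)) (-1) ^+ s *
    (a x (usubmx (row_perm s A)) * b x (dsubmx (row_perm s A))).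

Fixpoint wedge_pow (a : dform 2) (n : nat) : dform n.*2 :=
  match n with
  | 0 => fun _ _ => 1
  | n'.+1 => wedge a (@wedge_pow a n')
  end.
Arguments wedge_pow a n : clear implicits.

Definition pullback k f (a : dform k) : dform k :=
  fun x A => a (f x) (A *m tangent_map f x).

Definition diff_fun (u : M -> R) : dform 1 := fun x v =>
  'D_(v : 'rV[R]_m) (u \o param (chart_at x)) (coord (chart_at x) x).

Definition scale_form k (u : M -> R) (a : dform k) : dform k :=
  fun x A => u x * a x A.

Definition is_partition_of_unity (s : seq (chart R M m * (M -> R))) :=
  (forall i p, onth s i = Some p ->
    [/\ atlas p.1, smooth_fun p.2, (forall x, 0 <= p.2 x) &
        closure [set x | p.2 x != 0] `<=` cdom p.1]) /\
  (forall x, \sum_(p <- s) p.2 x = 1).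

(* Some finite partition of unity; one exists when M is compact, and the
   integral does not depend on which. *)
Definition partition_of_unity : seq (chart R M m * (M -> R)) :=
  match pselect (exists s, is_partition_of_unity s) with
  | left e => projT1 (cid e)
  | right _ => [::]
  end.

(* Integral over R^k as an iterated integral, which by Fubini is the Lebesgue
   integral for the continuous compactly supported functions it is used on. *)
Fixpoint iter_integral k : ('rV[R]_k -> R) -> R :=
  match k with
  | 0 => fun h => h 0
  | k'.+1 => fun h =>
      \int[lebesgue_measure]_(s in setT)
        iter_integral (fun v : 'rV[R]_k' => h (row_mx s%:M v))
  end.

(* vol only orients M, through its sign in each chart. *)
Definition form_integral (vol a : dform m) : R :=
  \sum_(p <- partition_of_unity)
    iter_integral (fun z : 'rV[R]_m =>
      if z \in cimg p.1 then
        p.2 (param p.1 z) *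
        (Num.sg (local_form vol p.1 z 1%:M) * local_form a p.1 z 1%:M)
      else 0).

Record is_metric (g : M -> 'rV[R]_m -> 'rV[R]_m -> R) : Prop := IsMetric {
  metric_linear : forall x (b : R) u v w,
    g x (b *: u + v) w = b * g x u w + g x v w ;
  metric_sym : forall x u v, g x u v = g x v u ;
  metric_pos : forall x u, u != 0 -> 0 < g x u u ;
  metric_smooth : forall c, atlas c -> forall u v, smooth_on (cimg c)
    (fun z => g (param c z) (u *m to_pref c z) (v *m to_pref c z)) }.

Section Distance.
Variable g : M -> 'rV[R]_m -> 'rV[R]_m -> R.

Definition curve_length (gam : R -> M) : R :=
  \int[lebesgue_measure]_(t in I01 R)
    Num.sqrt (g (gam t) (velocity gam t) (velocity gam t)).

(* [piecewise_length x y l]: some piecewise smooth curve from x to y has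
   length l; its pieces are all parametrized by [0, 1]. *)
Inductive piecewise_length : M -> M -> R -> Prop :=
| PiecewiseNil x : piecewise_length x x 0
| PiecewiseCons (gam : R -> M) y l :
    smooth_into (I01 R) gam -> piecewise_length (gam 1) y l ->
    piecewise_length (gam 0) y (curve_length gam + l).

Definition distance x y : R := inf [set l | piecewise_length x y l].

End Distance.

(* A path of bijections for t in [0, 1] given with the inverse bijections;
   the values for t outside [0, 1] are irrelevant. *)
Record bpath := BPath { fwd : R -> M -> M ; bwd : R -> M -> M }.

Definition id_path : bpath := BPath (fun _ => id) (fun _ => id).

Record is_isotopy (Phi : bpath) : Prop := IsIsotopy {
  isotopy_fwdK : forall t, I01 R t -> cancel (fwd Phi t) (bwd Phi t) ;
  isotopy_bwdK : forall t, I01 R t -> cancel (bwd Phi t) (fwd Phi t) ;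
  isotopy_smooth : smooth_map_path (fwd Phi) ;
  isotopy_bwd_smooth : forall t, I01 R t -> smooth_map (bwd Phi t) ;
  isotopy_start : fwd Phi 0 =1 id }.

Definition isotopy_field (Phi : bpath) t x : 'rV[R]_m :=
  velocity (fun s => fwd Phi s (bwd Phi t x)) t.

Definition dist_C0 (g : M -> 'rV[R]_m -> 'rV[R]_m -> R) (f h : M -> M) : R :=
  sup [set distance g (f x) (h x) | x in [set: M]].

Definition dist_bar g (Phi Psi : bpath) : R :=
  sup [set Num.max (dist_C0 g (fwd Phi t) (fwd Psi t))
                   (dist_C0 g (bwd Phi t) (bwd Psi t)) | t in I01 R].

(* The 1-form iota(X) omega + eta(X) eta at x, for a tangent vector X at x. *)
Definition I_map (eta : dform 1) (omega : dform 2) x (X v : 'rV[R]_m) : R :=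
  omega x (col_mx X v) + eta x X * eta x v.

Record is_cosymplectic (eta : dform 1) (omega : dform 2) : Prop :=
  IsCosymplectic {
    cosymplectic_eta_form : is_form eta ;
    cosymplectic_omega_form : is_form omega ;
    cosymplectic_eta_closed : closed_form eta ;
    cosymplectic_omega_closed : closed_form omega ;
    cosymplectic_bij : forall x (l : {linear 'rV[R]_m -> R^o}),
      exists! X : 'rV[R]_m, forall v, I_map eta omega x X v = l v }.

Definition is_cosymplectic_isotopy (eta : dform 1) (omega : dform 2)
    (Phi : bpath) :=
  is_isotopy Phi /\
  forall t, I01 R t -> pullback (fwd Phi t) eta = eta /\
                       pullback (fwd Phi t) omega = omega.

Record is_coHamiltonian (eta : dform 1) (omega : dform 2) (Phi : bpath)
    (F : R -> M -> R) : Prop := IsCoHamiltonian {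
  coHamiltonian_isotopy : is_cosymplectic_isotopy eta omega Phi ;
  coHamiltonian_smooth : smooth_fun_path F ;
  coHamiltonian_generated : forall t, I01 R t -> forall x v,
    I_map eta omega x (isotopy_field Phi t x) v = diff_fun (F t) x v }.

Definition boundary_flat (F : R -> M -> R) :=
  exists2 delta : R, 0 < delta < 1 &
    forall t, I01 R t -> t < delta \/ 1 - delta < t -> forall x, F t x = 0.

Definition C_fun (Phi : bpath) (eta : dform 1) t x : R :=
  eta (fwd Phi t x) (isotopy_field Phi t (fwd Phi t x)).

(* For cosymplectic isotopies [C_fun Phi eta t] is constant on M; this is its
   constant value. *)
Definition C_val (Phi : bpath) (eta : dform 1) t : R :=
  xget 0 [set a | forall x, C_fun Phi eta t x = a].

(* Here and below, sup and inf of continuous functions on compact sets stand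
   for max and min. *)
Definition osc (u : M -> R) : R := sup (range u) - inf (range u).

Definition D_CH (eta : dform 1) (Phi : bpath) (F : R -> M -> R)
    (Psi : bpath) (H : R -> M -> R) : R :=
  sup [set osc (fun x => F t x - H t x) +
           `|C_val Phi eta t - C_val Psi eta t| | t in I01 R].

End Geometry.

Arguments dform {R m} M k.
Arguments wedge_pow {R m M} a n x A.
Arguments bpath {R m} M.
Arguments id_path {R m} M.

(* The integral of u times eta /\ omega^n, M being oriented by that form. *)
Definition vol_integral (R : realType) (n : nat) (M : manifold R n.*2.+1)
    (eta : dform M 1) (omega : dform M 2) (u : M -> R) : R :=
  let vol : dform M n.*2.+1 := wedge eta (wedge_pow omega n) in
  form_integral vol (scale_form u vol).

Definition normalized (R : realType) (n : nat) (M : manifold R n.*2.+1)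
    (eta : dform M 1) (omega : dform M 2) (F : R -> M -> R) :=
  forall t, I01 R t -> vol_integral eta omega (F t) = 0.

(* Main.v *)
Require Import Defs.
From HB Require Import structures.
From mathcomp Require Import all_boot all_order all_algebra all_fingroup.
From mathcomp Require Import all_classical all_reals all_analysis.
From mathcomp Require Import ring lra.
(* [coord] means the coordinate map of a chart, not the coordinates in a basis. *)
Import Defs.
Set Implicit Arguments.
Unset Strict Implicit.
Unset Printing Implicit Defensive.
Import Order.TTheory GRing.Theory Num.Theory.
Import numFieldNormedType.Exports.
Local Open Scope classical_set_scope.
Local Open Scope ring_scope.

(** The isotopy [Phi] is run along another clock.  Let [z] be a smooth function of
    time that maps [0, 1] to itself, is constantly 0 near 0 and constantly 1
    near 1, and satisfies [0 <= z' <= 1 + e] and [|z t - t| <= e].  Put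
    Psi_t = Phi_(z t) and H_t = z'(t) F_(z t).

    The velocity of Psi at time [t] is [z' t] times the velocity of [Phi] at time
    [z t], so Psi is co-Hamiltonian and generated by H
    ([reparam_coHamiltonian]).  It has the same ends as [Phi]; H vanishes where
    [z' = 0], hence near both ends; and H_t has integral zero because the integral
    is homogeneous ([form_integral_scale]).

    Write D for the distance from [Phi] to the identity.  Since
    osc (F_t - z' F_(z t)) <= osc F_t + z' osc F_(z t), and since the constant
    value of eta on the velocity is multiplied by [z'] too, the distance from
    [Phi] to Psi is at most [(2 + e) * D] and that from Psi to the identity at
    most [(1 + e) * D] ([D_CH_reparam], [D_CH_reparam_id]).  Choosing [e] with
    [e * D < eps] gives both estimates with the constant 1.

    For the uniform distance, [Phi] and its inverse are continuous on the
    compact space [0, 1] x M ([path_nbhs], [isotopy_bwd_nbhs]), and the Riemannian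
    distance is small on small coordinate balls ([distance_nbhs]).  Hence points
    move little when the time moves by at most [e], uniformly ([uniform_small]).

    The clock ([exists_time_change]) is built from x exp (- d / x), which vanishes
    to infinite order at 0 and has slope between 0 and 1: bounding the slope of
    the clock by a number close to 1 is what makes the constants 2 and 3
    possible. *)

(** * Smooth functions on open sets *)

Section SmoothCalculus.
Context {R : realType}.
Implicit Types V W : normedModType R.

Lemma open_near V (U : set V) (P : V -> Prop) x :
  open U -> U x -> (forall y, U y -> P y) -> \forall y \near x, P y.
Proof.
move=> oU Ux UP; apply: filterS (open_nbhs_nbhs (conj oU Ux)) => y; exact: UP.
Qed.

(** The expansion of [f] at [x] is one of [g], and differentials are unique. *)
Lemma near_eq_differentiable V W (f g : V -> W) x :
  (\near x, f x = g x) -> differentiable f x -> differentiable g x.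
Proof.
move=> fg df.
have fgx : f x = g x by exact: nbhs_singleton fg.
have gE : g \o shift x = cst (g x) + 'd f x +o_ (0 : V) id.
  apply/eqaddoP => e e0.
  have : f \o shift x = cst (f x) + 'd f x +o_ (0 : V) id by exact: diff_locally.
  move=> /eqaddoP /(_ e e0) H.
  have fg0 : \forall y \near (0:V), f (y + x) = g (y + x).
    by move: fg; rewrite {1}(near_shift 0 x) /= ; apply: filterS => y /=; rewrite /= subr0.
  apply: filterS2 H fg0 => y.
  by rewrite !fctE /= => + <-; rewrite -fgx.
have dfc : continuous ('d f x) by exact: diff_continuous.
have dg := diff_unique dfc gE.
by apply/diff_locallyP; rewrite dg; split.
Qed.

Lemma scale_is_bilinear W : bilinear_for
    (GRing.Scale.Law.clone _ _ *:%R _) (GRing.Scale.Law.clone _ _ *:%R _)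
    (@GRing.scale R W).
Proof.
split=> [u'|u] a x y /=.
- by rewrite scalerDl scalerA.
- by rewrite scalerDr !scalerA mulrC.
Qed.

Lemma differentiable_scale V W (s : V -> R) (f : V -> W) x :
  differentiable s x -> differentiable f x ->
  differentiable (fun y => s y *: f y) x.
Proof.
move=> ds df.
pose bM := bilinear_isBilinear.Build R R W W _ _ _ (scale_is_bilinear W).
pose b : {bilinear R -> W -> W} := HB.pack (@GRing.scale R W) bM.
have db : differentiable (fun p : R * W => b p.1 p.2) (s x, f x).
  by apply: differentiable_bilin => p; exact: scale_continuous.
exact: (differentiable_comp (differentiable_pair ds df) db).
Qed.

Lemma derive_scale V W (s : V -> R) (f : V -> W) x v :
  differentiable s x -> differentiable f x ->
  'D_v (fun y => s y *: f y) x = 'D_v s x *: f x + s x *: 'D_v f x.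
Proof.
move=> ds df.
pose bM := bilinear_isBilinear.Build R R W W _ _ _ (scale_is_bilinear W).
pose b : {bilinear R -> W -> W} := HB.pack (@GRing.scale R W) bM.
have bc : continuous (fun p : R * W => b p.1 p.2) by move=> p; exact: scale_continuous.
have db p : differentiable (fun p : R * W => b p.1 p.2) p.
  exact: differentiable_bilin.
rewrite !deriveE //; last exact: differentiable_scale.
have -> : (fun y => s y *: f y) = (fun p => b p.1 p.2) \o (fun y => (s y, f y)) by [].
rewrite diff_comp //=; last exact: differentiable_pair.
rewrite diff_pair //=.
have := congr1 (fun h : _ -> _ => h ('d s x v, 'd f x v)) (diff_bilin (s x, f x) bc).
by move=> /= ->; rewrite addrC.
Qed.

(** Smoothness can be proved by exhibiting any class of functions that are
    differentiable on [U] and whose directional derivatives stay, on [U], in the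
    class: the iterated derivatives never leave it. *)
Lemma open_smooth_coind V W (U : set V) (P : (V -> W) -> Prop) :
  open U ->
  (forall f, P f -> forall x, U x -> differentiable f x) ->
  (forall f, P f -> forall v, exists2 g, P g & forall x, U x -> 'D_v f x = g x) ->
  forall f, P f -> open_smooth U f.
Proof.
move=> oU Pd PD f Pf vs.
suff [g Pg fg] : exists2 g, P g &
    forall x, U x -> foldr (fun v (h : V -> W) => 'D_v h) f vs x = g x.
  move=> x Ux; apply: near_eq_differentiable (Pd _ Pg _ Ux).
  by apply: (open_near oU Ux) => y Uy; rewrite fg.
elim: vs => [|v vs [g Pg fg]] /=; first by exists f.
have [h Ph gh] := PD _ Pg v; exists h => // x Ux.
by rewrite -gh //; apply: near_eq_derive; apply: (open_near oU Ux).
Qed.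

Lemma open_smooth_differentiable V W (U : set V) (f : V -> W) x :
  open_smooth U f -> U x -> differentiable f x.
Proof. by move=> sf; exact: (sf [::]). Qed.

Lemma open_smooth_derive V W (U : set V) (f : V -> W) v :
  open_smooth U f -> open_smooth U ('D_v f).
Proof. by move=> sf vs x Ux; have := sf (rcons vs v) x Ux; rewrite foldr_rcons. Qed.

Lemma open_smooth_sub V W (U U' : set V) (f : V -> W) :
  U' `<=` U -> open_smooth U f -> open_smooth U' f.
Proof. by move=> sU sf vs x /sU; exact: sf. Qed.

Lemma open_smooth_cst V W (U : set V) (a : W) : open U -> open_smooth U (cst a).
Proof.
move=> oU.
apply: (@open_smooth_coind _ _ U (fun f => exists a, f = cst a)) => //.
- by move=> _ [b ->] x _; exact: differentiable_cst.
- by move=> _ [b ->] v; exists (cst 0); [exists 0|move=> x _; rewrite derive_cst].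
- by exists a.
Qed.

(** Directional derivatives of [g \o k] and of products leave the class of
    composites and of products, but not the class that they span; an inductive
    span avoids writing its elements as indexed sums of products. *)
Inductive smooth_span V V' W (U : set V) (U' : set V') (k : V -> V') :
    (V -> W) -> Prop :=
| SpanComp g : open_smooth U' g -> smooth_span U U' k (g \o k)
| SpanScale (s : V -> R) (f : V -> W) : open_smooth U s -> smooth_span U U' k f ->
    smooth_span U U' k (fun x => s x *: f x)
| SpanAdd (f g : V -> W) : smooth_span U U' k f -> smooth_span U U' k g ->
    smooth_span U U' k (f + g).

(** The form in which the chain rule uses the smoothness of [k]: it turns
    ['D_v (g \o k)] into a smooth combination of the [('D_w g) \o k]. *)
Definition smooth_coordinates V V' (U : set V) (k : V -> V') :=
  forall v, exists (m : nat) (s : 'I_m -> V -> R) (w : 'I_m -> V'),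
    (forall i, open_smooth U (s i)) /\
    (forall x, U x -> 'D_v k x = \sum_(i < m) s i x *: w i).

Lemma smooth_span_sum V V' W (U : set V) (U' : set V') (k : V -> V')
    m (F : 'I_m -> V -> W) : open U' ->
  (forall i, smooth_span U U' k (F i)) ->
  smooth_span U U' k (fun x => \sum_(i < m) F i x).
Proof.
move=> oU' FS; rewrite -fct_sumE.
apply: (@big_ind _ (smooth_span U U' k)) => //; last exact: SpanAdd.
exact: (SpanComp U k (open_smooth_cst 0 oU')).
Qed.

(** The chain and Leibniz rules keep the span stable under directional
    derivatives. *)
Lemma smooth_span_smooth V V' W (U : set V) (U' : set V') (k : V -> V')
    (f : V -> W) :
  open U -> open U' -> (forall x, U x -> U' (k x)) ->
  (forall x, U x -> differentiable k x) -> smooth_coordinates U k ->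
  smooth_span U U' k f -> open_smooth U f.
Proof.
move=> oU oU' kU dk Dk; move: f.
have Sd (f : V -> W) : smooth_span U U' k f -> forall x, U x -> differentiable f x.
  elim=> {f} [g sg|s h ss _ IH|g h _ IHg _ IHh] x Ux.
  - apply: differentiable_comp; first exact: dk.
    exact: open_smooth_differentiable sg (kU _ Ux).
  - apply: differentiable_scale; last exact: IH.
    exact: open_smooth_differentiable Ux.
  - by apply: differentiableD; [exact: IHg|exact: IHh].
apply: (open_smooth_coind oU Sd) => f; elim=> [g sg|s h ss Sh IH|g h Sg IHg Sh IHh] v.
- have [m [s [w [ss Dkv]]]] := Dk v.
  pose d (x : V) : W := \sum_(i < m) s i x *: ('D_(w i) g) (k x).
  exists d.
    apply: (smooth_span_sum (F := fun i x => s i x *: ('D_(w i) g) (k x))) => // i.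
    apply: SpanScale => //.
    by apply: (SpanComp U k (g := 'D_(w i) g)); exact: open_smooth_derive.
  move=> x Ux; have dg := open_smooth_differentiable sg (kU _ Ux).
  rewrite deriveE; last by apply: differentiable_comp => //; exact: dk.
  rewrite diff_comp //=; last exact: dk.
  rewrite -(deriveE _ (dk _ Ux)) Dkv // linear_sum /=.
  by apply: eq_bigr => i _; rewrite linearZ /= deriveE.
- have [d Sd' Dh] := IH v.
  exists ((fun x => 'D_v s x *: h x) + (fun x => s x *: d x)).
    by apply: SpanAdd; apply: SpanScale => //; exact: open_smooth_derive.
  move=> x Ux; rewrite derive_scale ?Dh //; last exact: Sd.
  exact: open_smooth_differentiable Ux.
- have [d1 S1 D1] := IHg v; have [d2 S2 D2] := IHh v.
  exists (d1 + d2); first exact: SpanAdd.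
  move=> x Ux; rewrite deriveD ?D1 ?D2 //; apply: diff_derivable; exact: Sd Ux.
Qed.

Lemma open_smooth_comp V V' W (U : set V) (U' : set V') (k : V -> V')
    (g : V' -> W) :
  open U -> open U' -> (forall x, U x -> U' (k x)) ->
  (forall x, U x -> differentiable k x) -> smooth_coordinates U k ->
  open_smooth U' g -> open_smooth U (g \o k).
Proof. by move=> *; apply: smooth_span_smooth (SpanComp _ _ _); eassumption. Qed.

Lemma smooth_coordinates_id V (U : set V) : open U -> smooth_coordinates U id.
Proof.
move=> oU v; exists 1%N, (fun _ => cst 1), (fun _ => v); split=> [_|x _].
  exact: open_smooth_cst.
by rewrite big_ord1 derive_id scale1r.
Qed.

Lemma open_smooth_scale V W (U : set V) (s : V -> R) (f : V -> W) :
  open U -> open_smooth U s -> open_smooth U f ->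
  open_smooth U (fun x => s x *: f x).
Proof.
move=> oU ss sf; apply: (@smooth_span_smooth _ _ _ U U id) => //.
  exact: smooth_coordinates_id.
by apply: SpanScale => //; exact: (SpanComp U id sf).
Qed.

Lemma open_smoothD V W (U : set V) (f g : V -> W) :
  open U -> open_smooth U f -> open_smooth U g -> open_smooth U (f + g).
Proof.
move=> oU sf sg; apply: (@smooth_span_smooth _ _ _ U U id) => //.
  exact: smooth_coordinates_id.
by apply: SpanAdd; [exact: (SpanComp U id sf)|exact: (SpanComp U id sg)].
Qed.

Lemma smooth_coordinates_real (U : set R) (k : R -> R) :
  open U -> open_smooth U k -> smooth_coordinates U k.
Proof.
move=> oU sk v; exists 1%N, (fun _ => 'D_v k), (fun _ => 1); split=> [_|x Ux].
  exact: open_smooth_derive.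
by rewrite big_ord1 /= -[LHS]mulr1.
Qed.

Lemma open_smooth_id (V : normedModType R) (U : set V) : open U -> open_smooth U (@id V).
Proof.
move=> oU.
apply: (@open_smooth_coind _ _ U (fun f => f = id \/ exists a, f = cst a)) => //.
- move=> _ [->|[b ->]] x _; last exact: differentiable_cst.
  by case: (is_diff_id x).
- move=> _ [->|[b ->]] v; first by exists (cst v); [right; exists v|move=> x _; rewrite derive_id].
  by exists (cst 0); [right; exists 0|move=> x _; rewrite derive_cst].
- by left.
Qed.

Lemma derive_real (f : R -> R) (x v : R) : differentiable f x -> 'D_v f x = v * 'D_1 f x.
Proof. by move=> df; rewrite !deriveE // -{1}[v]mulr1 -[v * 1]/(v *: 1) linearZ. Qed.

Lemma open_smooth_compR (f g : R -> R) :
  open_smooth setT f -> open_smooth setT g -> open_smooth setT (f \o g).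
Proof.
move=> sf sg; apply: (open_smooth_comp openT openT) => //.
- by move=> x _; exact: open_smooth_differentiable sg I.
- exact: smooth_coordinates_real openT sg.
Qed.

End SmoothCalculus.

Section TimeChange.
Context {R : realType}.
Implicit Types V W : normedModType R.

Lemma is_diff_fst V W (p : V * W) : is_diff p fst fst.
Proof.
have c : continuous (fst : V * W -> V) by move=> x; exact: cvg_fst.
have l : linear (fst : V * W -> V) by [].
pose fM := GRing.isLinear.Build _ _ _ _ _ l.
pose F : {linear [the lmodType R of (V * W)%type] -> V} := HB.pack (fst : V * W -> V) fM.
split; first exact: (@linear_differentiable _ _ _ F).
exact: (@diff_lin _ _ _ F).
Qed.

Lemma is_diff_snd V W (p : V * W) : is_diff p snd snd.
Proof.
have c : continuous (snd : V * W -> W) by move=> x; exact: cvg_snd.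
have l : linear (snd : V * W -> W) by [].
pose fM := GRing.isLinear.Build _ _ _ _ _ l.
pose F : {linear [the lmodType R of (V * W)%type] -> W} := HB.pack (snd : V * W -> W) fM.
split; first exact: (@linear_differentiable _ _ _ F).
exact: (@diff_lin _ _ _ F).
Qed.

Lemma open_smooth_fst W V (U : set (V * W)) (f : V -> R) :
  open U -> open_smooth setT f -> open_smooth U (f \o fst).
Proof.
move=> oU sf.
apply: (open_smooth_comp oU openT) => //.
- by move=> p _; case: (is_diff_fst p).
- by move=> v; exists 1%N, (fun _ => cst 1), (fun _ => v.1); split=> [_|p _];
    [exact: open_smooth_cst|
     rewrite big_ord1 scale1r; case: (is_diff_fst p) => d e; rewrite deriveE // e].
Qed.

(** [k] has derivative [z'(t) *: (1, 0)] in time and the identity in space. *)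
Lemma open_smooth_time_change W W' (z : R -> R) (U : set (R * W))
    (g : R * W -> W') :
  open_smooth setT z -> open U -> open_smooth U g ->
  let k := fun p : R * W => (z p.1, p.2) in
  open (k @^-1` U) /\ open_smooth (k @^-1` U) (g \o k).
Proof.
move=> sz oU sg k.
have dz t : differentiable z t by exact: open_smooth_differentiable sz _.
have dk (p : R * W) : is_diff p k (fun v : R * W => ('d z (p.1) (v.1), v.2)).
  have dzp : is_diff (p.1) z ('d z (p.1)) by split.
  exact: is_diff_pair (is_diff_comp (is_diff_fst p) dzp) (is_diff_snd p).
have dk1 p : differentiable k p by case: (dk p).
have kc : continuous k.
  by move=> p; apply: differentiable_continuous.
have oU' : open (k @^-1` U) by apply: open_comp => // p _; exact: kc.
split=> //.
apply: (open_smooth_comp oU' oU) => // v.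
pose s (i : 'I_2) (p : R * W) : R := if i == ord0 then 'D_(v.1) z p.1 else 1.
pose w (i : 'I_2) : R * W := if i == ord0 then (1, 0) else (0, v.2).
exists 2%N, s, w; split=> [i|p _].
  rewrite /s; case: eqP => _; last exact: open_smooth_cst.
  by apply: (open_smooth_fst (f := 'D_(v.1) z)) => //; exact: open_smooth_derive.
rewrite big_ord_recl big_ord1 /s /w /= deriveE //.
have [_ ->] := dk p; rewrite deriveE //.
congr (_, _); rewrite /= ?scaler0 ?scale1r ?add0r ?addr0 //.
by rewrite -[LHS]mulr1.
Qed.

End TimeChange.

(** * A smooth clock that stops near both ends *)

Section Flat.
Context {R : realType}.
Variable d : R.
Hypothesis d0 : 0 < d.

(** The functions [x^-n exp (- d / x)], continued by zero; each derivative is a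
    combination of two of them. *)
Definition flat (n : nat) (x : R) : R :=
  if 0 < x then x^-1 ^+ n * expR (- (d * x^-1)) else 0.

Lemma flat_le0 n x : x <= 0 -> flat n x = 0.
Proof. by rewrite /flat; case: ltP. Qed.

Lemma flat_gt0 n x : 0 < x -> flat n x = x^-1 ^+ n * expR (- (d * x^-1)).
Proof. by rewrite /flat => ->. Qed.

(** The term of degree [n + 2] of the exponential series at [d / x] gives the
    bound, which makes the derivative at [0] vanish. *)
Lemma flat_bound n : exists2 C : R, 0 < C & forall x, `|flat n x| <= C * `|x| ^+ 2.
Proof.
pose C : R := (n.+2)`!%:R / d ^+ n.+2.
have C0 : 0 < C by rewrite divr_gt0 ?exprn_gt0 ?ltr0n ?fact_gt0.
exists C => // x; case: (ltP 0 x) => [x0|x0]; last first.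
  by rewrite flat_le0 // normr0 mulr_ge0 ?exprn_ge0 // ltW.
rewrite flat_gt0 // ger0_norm; last first.
  by rewrite mulr_ge0 ?expR_ge0 // exprn_ge0 // invr_ge0 ltW.
rewrite (gtr0_norm x0) expRN.
have u0 : 0 < d * x^-1 by rewrite mulr_gt0 ?invr_gt0.
have := expR_ge1Dxn n.+1 (ltW u0); set e := expR _ => H.
have e0 : 0 < e by exact: expR_gt0.
have {}H : (d * x^-1) ^+ n.+2 / (n.+2)`!%:R <= e by apply: le_trans H; rewrite lerDr ler01.
rewrite ler_pdivrMr //.
apply: le_trans (_ : C * x ^+ 2 * ((d * x^-1) ^+ n.+2 / (n.+2)`!%:R) <= _); last first.
  by apply: ler_wpM2l H; rewrite mulr_ge0 ?exprn_ge0 // ltW.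
have xn : x != 0 by rewrite gt_eqF.
have dn : d != 0 by rewrite gt_eqF.
have fn : (n.+2)`!%:R != 0 :> R by rewrite pnatr_eq0 -lt0n fact_gt0.
rewrite le_eqVlt; apply/orP; left; apply/eqP.
have -> : x^-1 ^+ n = x^-1 ^+ n.+2 * x ^+ 2.
  by rewrite -addn2 exprD -mulrA -exprMn mulVf // expr1n mulr1.
rewrite /C exprMn; field.
by rewrite fn expf_neq0.
Qed.

Lemma flat_derive (n : nat) (x : R) :
  is_derive x (1 : R) (flat n) (d * flat n.+2 x - n%:R * flat n.+1 x).
Proof.
case: (ltrgtP x 0) => [x0|x0|->].
- rewrite !flat_le0 ?ltW // !mulr0 subr0.
  apply: (@near_eq_is_derive _ _ _ (cst 0)).
    by near=> y; rewrite /= flat_le0 //; near: y; apply: filterS (lt_nbhsl x0) => y /ltW.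
- have xn : x != 0 by rewrite gt_eqF.
  rewrite !flat_gt0 //.
  apply: (@near_eq_is_derive _ _ _ ((fun y => y^-1) ^+ n * (expR \o (fun y => - (d * y^-1))))).
    near=> y; rewrite flat_gt0; last by near: y; exact: lt_nbhsr.
    by rewrite !fctE.
  have D1 : is_derive x 1 (fun y : R => y^-1) (- x ^- 2).
    have di : derivable (@id R) x 1 by exact: derivable_id.
    split; first exact: (derivableV (f := id) xn di).
    by rewrite (deriveV (f := id) xn di) derive_id [LHS]mulr1.
  have D2 : is_derive x 1 (fun y : R => - (d * y^-1)) (d * x ^- 2).
    by apply: (is_derive_eq (is_deriveN (is_deriveZ d D1))); rewrite scalerN opprK.
  have D3 := is_derive1_comp (is_derive_expR _) D2.
  apply: (is_derive_eq (is_deriveM (is_deriveX n D1) D3)).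
  rewrite !fctE /= -![_ *: _]/(_ * _) -exprVn.
  case: n => [|n] /=; first by rewrite mul0r; ring.
  by rewrite !exprS; ring.
- rewrite !flat_le0 // !mulr0 subr0.
  have [C C0 HC] := flat_bound n.
  suff cv : (fun h : R =>
      h^-1 *: ((flat n \o shift 0) (h *: (1 : R)) - flat n 0)) @ 0^' --> (0 : R).
    by split; [apply/cvg_ex; exists 0|exact: cvg_lim].
  apply/cvgr0Pnorm_le => e e0.
  near=> h.
  rewrite flat_le0 // subr0 /= addr0 [h *: 1]mulr1 normrM normfV.
  have h0 : 0 < `|h| by rewrite normr_gt0; near: h; exact: nbhs_dnbhs_neq.
  rewrite ler_pdivrMl // (le_trans (HC h)) //.
  rewrite expr2 mulrA mulrC ler_pM2l // -ler_pdivlMl //.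
  near: h; apply: dnbhs0_le. by rewrite mulr_gt0 ?invr_gt0.
Unshelve. all: by end_near.
Qed.

End Flat.

Section Ramp.
Context {R : realType}.

Variable d : R.
Hypothesis d0 : 0 < d.
Notation flat := (flat d).

Inductive flat_span : (R -> R) -> Prop :=
| FlatSpan n : flat_span (flat n)
| FlatSpanZ (c : R) f : flat_span f -> flat_span (c *: f)
| FlatSpanD f g : flat_span f -> flat_span g -> flat_span (f + g).

Lemma open_smooth_flat n : open_smooth setT (flat n).
Proof.
have dflat m x : differentiable (flat m) x.
  by apply/derivable1_diffP; case: (flat_derive d0 m x).
have sd f : flat_span f -> forall x, setT x -> differentiable f x.
  by elim=> [m x _|c g _ IH x Tx|g h _ IHg _ IHh x Tx];
    [exact: dflat|apply: differentiableZ; exact: IH|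
     apply: differentiableD; [exact: IHg|exact: IHh]].
apply: (open_smooth_coind openT sd); last exact: FlatSpan.
move=> f sf v.
suff [g sg fg] : exists2 g, flat_span g & forall x, 'D_1 f x = g x.
  exists (v *: g); first exact: FlatSpanZ.
  by move=> x _; rewrite derive_real ?fg //; exact: sd.
elim: sf => [m|c g sg [g' sg' gg']|g h sg [g' sg' gg'] sh [h' sh' hh']].
- exists (d *: flat m.+2 + (- m%:R) *: flat m.+1).
    by apply: FlatSpanD; apply: FlatSpanZ; exact: FlatSpan.
  by move=> x; have [_ ->] := flat_derive d0 m x; rewrite -mulNr.
- exists (c *: g'); first exact: FlatSpanZ.
  by move=> x; rewrite deriveZ ?gg' //; apply: diff_derivable; exact: sd.
- exists (g' + h'); first exact: FlatSpanD.
  by move=> x; rewrite deriveD ?gg' ?hh' //; apply: diff_derivable; exact: sd.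
Qed.

(** A smooth substitute for the positive part: with [u = d / x], its derivative
    [(1 + u) exp (- u)] lies between 0 and 1, and it differs from the positive
    part by at most [d]. *)
Definition ramp (x : R) : R := x * flat 0 x.

Lemma open_smooth_ramp : open_smooth setT ramp.
Proof.
apply: (@open_smooth_scale _ _ _ setT id (flat 0)) => //.
- exact: openT.
- exact: open_smooth_id openT.
- exact: open_smooth_flat.
Qed.

Definition ramp' (x : R) : R := flat 0 x + x * (d * flat 2 x).

Lemma ramp_derive (x : R) : is_derive x 1 ramp (ramp' x).
Proof.
have D := is_deriveM (is_derive_id x (1:R)) (flat_derive d0 0 x).
apply: (is_derive_eq D).
by rewrite -![_ *: _]/(_ * _) mul0r subr0 mulr1 addrC.
Qed.

Lemma ramp'_le0 x : x <= 0 -> ramp' x = 0.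
Proof. by move=> x0; rewrite /ramp' !flat_le0 // !mulr0 addr0. Qed.

Lemma ramp'_itv x : 0 <= ramp' x <= 1.
Proof.
have [x0|x0] := leP x 0; first by rewrite ramp'_le0 // lexx ler01.
have xn : x != 0 by rewrite gt_eqF.
have u0 : 0 < d * x^-1 by rewrite mulr_gt0 ?invr_gt0.
have -> : ramp' x = (1 + d * x^-1) / expR (d * x^-1).
  rewrite /ramp' !flat_gt0 // expRN; set e := (expR _)^-1.
  by field.
rewrite ler_pdivrMr ?expR_gt0 // mul1r expR_ge1Dx andbT.
by rewrite divr_ge0 ?expR_ge0 // addr_ge0 // ltW.
Qed.

Lemma ramp_le0 x : x <= 0 -> ramp x = 0.
Proof. by move=> x0; rewrite /ramp flat_le0 // mulr0. Qed.

Lemma ramp_ge x : x - d <= ramp x.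
Proof.
have [x0|x0] := leP x 0.
  by rewrite ramp_le0 // lerBlDr add0r (le_trans x0) ?ltW.
rewrite /ramp flat_gt0 // expr0 mul1r.
have xn : x != 0 by rewrite gt_eqF.
have := expR_ge1Dx (- (d * x^-1)) => /(ler_wpM2l (ltW x0)).
by apply: le_trans; rewrite mulrDr mulr1 mulrN mulrCA mulfV // mulr1.
Qed.

Lemma ramp_le x : 0 <= x -> ramp x <= x.
Proof.
rewrite le_eqVlt => /orP[/eqP<-|x0]; first by rewrite ramp_le0.
rewrite /ramp flat_gt0 // expr0 mul1r; apply: ler_piMr; first exact: ltW.
by rewrite expR_le1 oppr_le0; apply: mulr_ge0; rewrite ?invr_ge0 ltW.
Qed.

Lemma ramp_ge0 x : 0 <= ramp x.
Proof.
have [x0|x0] := leP x 0; first by rewrite ramp_le0.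
by rewrite /ramp flat_gt0 // expr0 mul1r mulr_ge0 ?expR_ge0 // ltW.
Qed.

Lemma ramp_homo x y : x <= y -> ramp x <= ramp y.
Proof.
move=> xy.
have [c _ E] := MVT_segment (f := ramp) (df := ramp') xy (fun x _ => ramp_derive x)
  (continuous_subspaceT (fun x => differentiable_continuous
    (open_smooth_differentiable open_smooth_ramp I))).
rewrite -subr_ge0 E mulr_ge0 ?subr_ge0 //.
by case/andP: (ramp'_itv c).
Qed.

End Ramp.

(** The ramp [t |-> ramp (t - d)] stops before [d]; bending it once more by the
    reflected ramp [y |-> ramp (L - y)] stops it when it reaches the level [L].
    Both bends have slope at most 1, so only the division by [ramp L], which is
    close to 1, can push the slope above 1. *)
Lemma exists_time_change {R : realType} (e : R) : 0 < e ->
  exists z : R -> R,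
  [/\ open_smooth setT z, z 0 = 0 /\ z 1 = 1,
      (forall t, I01 R t -> I01 R (z t) /\ `|z t - t| <= e),
      (forall t, 0 <= 'D_1 z t <= 1 + e) &
      exists2 c : R, 0 < c < 1 & forall t, t < c \/ 1 - c < t -> 'D_1 z t = 0].
Proof.
move=> e0.
pose d := Num.min (e / 16%:R) (16%:R^-1 : R).
have d0 : 0 < d by rewrite lt_min; apply/andP; split; lra.
have de : d <= e / 16%:R by rewrite ge_min lexx.
have d1 : d <= 16%:R^-1 by rewrite ge_min lexx orbT.
clearbody d.
(* At time [1 - d] the first ramp is at least [1 - 3 * d], since it loses [d] by
   the shift and at most [d] by the bend. *)
pose L : R := 1 - 3 * d.
pose r := ramp d L.
have r1 : 1 - 4 * d <= r by have := ramp_ge d0 L; rewrite /r /L; lra.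
have r2 : r <= 1 by apply: le_trans (ramp_le d0 _) _; rewrite /L; lra.
have r0 : 0 < r by lra.
pose z t := (r - ramp d (L - ramp d (t - d))) / r.
pose z' t := ramp' d (L - ramp d (t - d)) * ramp' d (t - d) / r.
have zd (t : R) : is_derive t (1 : R) z (z' t).
  have D1 : is_derive t (1 : R) (fun t : R => t - d) 1.
    apply: (is_derive_eq (is_deriveB (is_derive_id t (1 : R)) (is_derive_cst d t (1 : R)))).
    by rewrite subr0.
  have D2 : is_derive t (1 : R) (fun t => ramp d (t - d)) (ramp' d (t - d)).
    by apply: (is_derive_eq (is_derive1_comp (ramp_derive d0 _) D1)); rewrite mulr1.
  have D3 : is_derive t (1 : R) (fun t => L - ramp d (t - d)) (- ramp' d (t - d)).
    by apply: (is_derive_eq (is_deriveB (is_derive_cst L t (1 : R)) D2)); rewrite sub0r.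
  have D4 := is_deriveB (is_derive_cst r t (1 : R)) (is_derive1_comp (ramp_derive d0 _) D3).
  have D5 := is_deriveZ r^-1 D4.
  have -> : z = r^-1 *: (cst r - (ramp d \o (fun t => L - ramp d (t - d)))).
    by apply/funext => u; rewrite /z mulrC.
  by apply: (is_derive_eq D5); rewrite sub0r mulrN opprK -[LHS]/(_ * _) mulrC.
have zI t : 0 <= z t <= 1.
  have H1 := ramp_ge0 d (t - d).
  have H2 := ramp_ge0 d (L - ramp d (t - d)).
  have H3 : ramp d (L - ramp d (t - d)) <= r by apply: ramp_homo => //; lra.
  by rewrite /z ler_pdivrMr // divr_ge0 //=; lra.
have z0 t : t <= d -> z t = 0.
  by move=> td; rewrite /z (@ramp_le0 _ _ (t - d)) ?subr0 ?subrr ?mul0r //; lra.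
have y1 t : 1 - d <= t -> L - ramp d (t - d) <= 0.
  by move=> td; have := ramp_ge d0 (t - d); rewrite /L; lra.
have z1 t : 1 - d <= t -> z t = 1.
  by move=> td; rewrite /z ramp_le0 ?subr0 ?mulfV ?gt_eqF // y1.
exists z; split.
- have sa (a : R) (f : R -> R) : open_smooth setT f -> open_smooth setT (fun t => a - f t).
    move=> sf; apply: (@open_smoothD _ _ _ setT (cst a) (fun t => - f t)).
    + exact: openT.
    + exact: open_smooth_cst openT.
    + have -> : (fun t => - f t) = (fun t => cst (-1 : R) t *: f t).
        by apply/funext => t; rewrite scaleN1r.
      by apply: open_smooth_scale sf; [exact: openT|exact: open_smooth_cst openT].
  have -> : z = (fun t => cst r^-1 t *: (r - ramp d (L - ramp d (t - d)))).
    by apply/funext => t; rewrite /z mulrC.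
  apply: open_smooth_scale; [exact: openT|exact: open_smooth_cst openT|].
  apply: (sa); apply: (@open_smooth_compR _ (ramp d)); first exact: open_smooth_ramp.
  apply: (sa); apply: (@open_smooth_compR _ (ramp d)); first exact: open_smooth_ramp.
  apply: open_smoothD; [exact: openT|exact: open_smooth_id openT|exact: open_smooth_cst openT].
- by rewrite z0 ?z1 //; lra.
- move=> t; rewrite /I01 /= !in_itv /= => /andP[t0 t1]; split=> //.
  have zI' := zI t.
  have zr : z t * r = r - ramp d (L - ramp d (t - d)) by rewrite /z mulfVK // gt_eqF.
  have y1' : t - 2 * d <= ramp d (t - d) by have := ramp_ge d0 (t - d); lra.
  have y2' : ramp d (t - d) <= t.
    have [td|td] := leP (t - d) 0; first by rewrite ramp_le0.
    by have := ramp_le d0 (ltW td); lra.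
  have w1 : 1 - t - 4 * d <= ramp d (L - ramp d (t - d)).
    by have := ramp_ge d0 (L - ramp d (t - d)); rewrite {1}/L; lra.
  have w2 : ramp d (L - ramp d (t - d)) <= 1 - t.
    have [td|td] := leP (L - ramp d (t - d)) 0; first by rewrite ramp_le0 //; lra.
    by have := ramp_le d0 (ltW td); rewrite {2}/L; lra.
  have zr2 : z t * (1 - r) <= 4 * d.
    case/andP: zI' => za zb; nra.
  have zr3 : 0 <= z t * (1 - r).
    by case/andP: zI' => za zb; apply: mulr_ge0; lra.
  by rewrite ler_norml; lra.
- move=> t; have [_ ->] := zd t; rewrite /z'.
  have /andP[a0 a1] := ramp'_itv d0 (L - ramp d (t - d)).
  have /andP[b0 b1] := ramp'_itv d0 (t - d).
  apply/andP; split; first by apply: divr_ge0; [exact: mulr_ge0|exact: ltW].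
  rewrite ler_pdivrMr //.
  apply: le_trans (_ : 1 <= _); first exact: mulr_ile1.
  nra.
- exists d; first lra.
  move=> t [td|td]; have [_ ->] := zd t; rewrite /z'.
    by rewrite (@ramp'_le0 _ _ (t - d)) ?mulr0 ?mul0r //; lra.
  by rewrite ramp'_le0 ?mul0r //; apply: y1; lra.
Qed.

(** * Homogeneity of the integral *)

Section IntegralScale.
Context {d} {T : measurableType d} {R : realType}.
Variable mu : {measure set T -> \bar R}.
Import HBNNSimple.
Local Open Scope ereal_scope.

(** The integral of a nonnegative function is the supremum of the integrals of the
    simple functions below it, so this and the next lemmas hold for functions
    that are not known to be measurable, such as the inner integrals of an
    iterated integral and the speed of a curve. *)
Lemma ge0_integral_homo (f g : T -> \bar R) :
  (forall x, 0 <= f x) -> (forall x, f x <= g x) ->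
  \int[mu]_x f x <= \int[mu]_x g x.
Proof.
move=> f0 fg; have g0 x : 0 <= g x by exact: le_trans (f0 x) (fg x).
rewrite !ge0_integralTE //; apply: ereal_sup_le => _ /= [h hf <-].
exists h => // x; exact: le_trans (hf x) (fg x).
Qed.

Lemma ge0_integral_scale_le (f : T -> \bar R) (k : R) :
  (0 < k)%R -> (forall x, 0 <= f x) ->
  k%:E * \int[mu]_x f x <= \int[mu]_x (k%:E * f x).
Proof.
move=> k0 f0.
have kf0 x : 0 <= k%:E * f x by rewrite mule_ge0 // lee_fin ltW.
rewrite !ge0_integralTE // -ereal_sup_pZl //; apply: ge_ereal_sup.
move=> _ /= [_ [h hf <-] <-]; apply: ereal_sup_ubound => /=.
exists (scale_nnsfun h (ltW k0)); last by rewrite -sintegralrM.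
by move=> x /=; rewrite EFinM lee_wpmul2l // lee_fin ltW.
Qed.

Lemma ge0_integral_scale (f : T -> \bar R) (k : R) :
  (0 < k)%R -> (forall x, 0 <= f x) ->
  \int[mu]_x (k%:E * f x) = k%:E * \int[mu]_x f x.
Proof.
move=> k0 f0.
have kf0 x : 0 <= k%:E * f x by rewrite mule_ge0 // lee_fin ltW.
apply/eqP; rewrite eq_le ge0_integral_scale_le // andbT.
have ki0 : (0 < k^-1)%R by rewrite invr_gt0.
have := ge0_integral_scale_le ki0 kf0.
under [X in _ <= X -> _]eq_integral do rewrite muleA -EFinM mulVf ?gt_eqF // mul1e.
by rewrite lee_pdivrMl.
Qed.

End IntegralScale.

(** For [k > 0], multiplication by [k] is compatible even with the conventions
    for infinite and undefined integrals. *)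
Lemma RintegralZl_ge0 {d} {T : measurableType d} {R : realType}
  (mu : {measure set T -> \bar R}) (f : T -> R) (k : R) : 0 <= k ->
  \int[mu]_x (k * f x) = k * \int[mu]_x f x.
Proof.
rewrite le_eqVlt => /orP[/eqP<-|k0].
  rewrite mul0r; under eq_Rintegral do rewrite mul0r.
  by rewrite /Rintegral integral0.
rewrite /Rintegral.
under eq_integral do rewrite EFinM.
rewrite integralE.
under eq_integral do rewrite ge0_funeposM ?ltW//.
under [X in (_ - X)%E]eq_integral do rewrite ge0_funenegM ?ltW//.
rewrite !ge0_integral_scale // [in RHS]integralE.
set a := integral _ _ _; set b := integral _ _ _.
have kE : (0 < k%:E)%E by rewrite lte_fin.
move: a b => [a| |] [b| |] //=; first by rewrite mulrBr.
all: by rewrite ?(gt0_muley kE) ?(gt0_muleNy kE) /= mulr0.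
Qed.

Lemma iter_integral_scale {R : realType} n (h : 'rV[R]_n -> R) (k : R) : 0 <= k ->
  iter_integral (fun z => k * h z) = k * iter_integral h.
Proof.
move=> k0; elim: n h => [|n IH] h //=.
rewrite -RintegralZl_ge0 //; apply: eq_Rintegral => s _.
exact: (IH (fun v => h (@row_mx _ 1 1 n s%:M v))).
Qed.

Lemma form_integral_scale {R : realType} {m : nat} {M : manifold R m}
  (vol a : dform M m) (k : R) (u : M -> R) : 0 <= k ->
  form_integral vol (scale_form (fun x => k * u x) a) =
  k * form_integral vol (scale_form u a).
Proof.
move=> k0; rewrite /form_integral mulr_sumr; apply: eq_bigr => p _.
rewrite -iter_integral_scale //; congr iter_integral; apply/funext => z.
case: ifP => _; last by rewrite mulr0.
by rewrite /local_form /scale_form; ring.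
Qed.

(** * Curves and velocities in charts *)

Lemma continuous_withinP {T U : topologicalType} (A : set T) (f : T -> U) :
  {within A, continuous f} <->
  forall x, A x -> forall N, nbhs (f x) N -> \forall y \near x, A y -> N (f y).
Proof. exact: subspace_continuousP. Qed.

Lemma open_within_nbhs {T U : topologicalType} (A : set T) (f : T -> U) x (N : set U) :
  open A -> {within A, continuous f} -> A x -> nbhs (f x) N ->
  \forall y \near x, A y /\ N (f y).
Proof.
move=> oA /continuous_withinP cf Ax /(cf x Ax) AN.
have A' : \forall y \near x, A y by apply: open_nbhs_nbhs; split.
by near=> y; have Ay : A y by [near: y]; split => //; near: y;
   apply: filterS2 AN A' => y /[apply].
Unshelve. all: by end_near. Qed.

Section Charts.
Context {R : realType} {m : nat} {M : manifold R m}.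
Implicit Types (c : chart R M m) (x : M).

Lemma coord_paramK c z : atlas c -> cimg c z -> cdom c (param c z) /\ coord c (param c z) = z.
Proof.
move=> ac [x cx <-].
by rewrite (coordK (atlas_chart ac)) // inE.
Qed.

Lemma param_coordK c x : atlas c -> cdom c x -> param c (coord c x) = x.
Proof. by move=> ac cx; rewrite (coordK (atlas_chart ac)) // inE. Qed.

Lemma cimg_coord c x : cdom c x -> cimg c (coord c x).
Proof. by move=> cx; exists x. Qed.

Lemma param_nbhs c z N : atlas c -> cimg c z -> nbhs (param c z) N ->
  \forall w \near z, cimg c w /\ N (param c w).
Proof.
move=> /atlas_chart ac; apply: open_within_nbhs; first exact: cimg_open.
exact: param_continuous.
Qed.

Lemma coord_nbhs c x N : atlas c -> cdom c x -> nbhs (coord c x) N ->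
  \forall y \near x, cdom c y /\ N (coord c y).
Proof.
move=> /atlas_chart ac; apply: open_within_nbhs; first exact: cdom_open.
exact: coord_continuous.
Qed.

Lemma cdom_nbhs c x : atlas c -> cdom c x -> nbhs x (cdom c).
Proof. by move=> /atlas_chart ac cx; apply: open_nbhs_nbhs; split=> //; exact: cdom_open. Qed.

Lemma smooth_on_near {V W : normedModType R} (A : set V) (f : V -> W) (x : V) :
  smooth_on A f -> A x -> exists h : V -> W,
   exists U, [/\ open U, U x, open_smooth U h & forall y, U y -> A y -> f y = h y].
Proof.
move=> sf Ax; have [U [h [oU Ux sh fh]]] := sf x Ax.
by exists h, U; split=> // y Uy Ay; apply: fh; rewrite inE.
Qed.

Lemma transition_smooth c c' z : atlas c -> atlas c' -> cimg c z ->
  cdom c' (param c z) ->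
  exists h : 'rV[R]_m -> 'rV[R]_m, exists U, [/\ open U, U z, open_smooth U h &
    forall w, U w -> [/\ cimg c w, cdom c' (param c w) & coord c' (param c w) = h w]].
Proof.
move=> ac ac' cz c'z.
have [cpz cpK] := coord_paramK ac cz.
have [h [U [oU Uz sh fh]]] := smooth_on_near (atlas_compatible ac ac')
  (ex_intro2 _ _ (param c z) (conj cpz c'z) cpK).
have : nbhs z (U `&` [set w | cimg c w /\ cdom c' (param c w)]).
  apply: filterI; first by apply: open_nbhs_nbhs; split.
  exact: param_nbhs (cdom_nbhs ac' c'z).
rewrite nbhsE => -[U' [oU' U'z] U'U].
exists h, U'; split=> //; first by apply: open_smooth_sub sh => w /U'U [].
move=> w /U'U [Uw [cw c'w]]; split=> //; apply: fh => //.
have [cpw cwK] := coord_paramK ac cw.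
by exists (param c w).
Qed.

Lemma transition_differentiable c c' z : atlas c -> atlas c' -> cimg c z ->
  cdom c' (param c z) -> differentiable (coord c' \o param c) z.
Proof.
move=> ac ac' cz c'z.
have [h [U [oU Uz sh fh]]] := transition_smooth ac ac' cz c'z.
apply: near_eq_differentiable (open_smooth_differentiable sh Uz).
by apply: (open_near oU Uz) => w /fh [].
Qed.

Lemma derive_to_pref c z v : atlas c -> cimg c z ->
  'D_v (coord (chart_at (param c z)) \o param c) z = v *m to_pref c z.
Proof.
move=> ac cz; rewrite deriveEjacobian //.
by apply: transition_differentiable => //; [exact: chart_at_atlas|exact: chart_at_dom].
Qed.

(** Every time of the interval has other times of it on at least one side. *)
Lemma within_I01_proper t : I01 R t -> ProperFilter (within (I01 R) t^').
Proof.
rewrite /I01 /= in_itv /= => /andP[t0 t1].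
apply: Build_ProperFilter_ex => P; rewrite /within /dnbhs /within /= => /nbhs_ballP[e /= e0 eP].
(* A step towards the farther end, of length at most [1 / 4], stays inside. *)
pose s := if t < 1 / 2 then t + Num.min (e / 2) (1 / 4) else t - Num.min (e / 2) (1 / 4).
have u0 : 0 < Num.min (e / 2) (1 / 4) by rewrite lt_min; apply/andP; split; lra.
have u1 : Num.min (e / 2) (1 / 4) <= e / 2 by rewrite ge_min lexx.
have u2 : Num.min (e / 2) (1 / 4) <= 1 / 4 by rewrite ge_min lexx orbT.
move: u0 u1 u2 @s; set u := Num.min _ _ => u0 u1 u2 s.
exists s; apply: eP; rewrite /ball /= /s; case: (ltP t (1 / 2)) => th.
- by rewrite opprD addNKr normrN gtr0_norm //; lra.
- by rewrite opprB addrCA subrr addr0 gtr0_norm //; lra.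
- by rewrite -subr_eq0 addrAC subrr add0r gt_eqF.
- by rewrite -subr_eq0 addrAC subrr add0r oppr_eq0 gt_eqF.
- by rewrite in_itv /=; apply/andP; split; lra.
- by rewrite in_itv /=; apply/andP; split; lra.
Qed.

Lemma deriv01E (h k : R -> 'rV[R]_m) t : I01 R t -> differentiable k t ->
  (\forall s \near t, I01 R s -> h s = k s) -> deriv01 h t = 'D_1 k t.
Proof.
move=> It dk hk.
have PF := within_I01_proper It.
apply: (cvg_lim (@norm_hausdorff _ _)).
have ht : h t = k t by exact: nbhs_singleton hk It.
apply/cvgrPdist_le => e e0.
have dk1 : derivable k t 1 by exact: diff_derivable.
have /cvgrPdist_le /(_ e e0) H := dk1.
have H0 : \forall u \near (0 : R), u != 0 ->
    `|'D_1 k t - u^-1 *: (k (u *: 1 + t) - k t)| <= e := H.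
have H' : \forall s \near t, s - t != 0 ->
    `|'D_1 k t - (s - t)^-1 *: (k s - k t)| <= e.
  rewrite (near_shift 0 t); apply: filterS H0 => u /= Hu.
  by rewrite subr0 addrK => /Hu; rewrite [u *: 1]mulr1.
have : \forall s \near t, s != t -> I01 R s ->
    `|'D_1 k t - (s - t)^-1 *: (h s - h t)| <= e.
  apply: filterS2 H' hk => s H1 hks st Is.
  by rewrite ht hks //; apply: H1; rewrite subr_eq0.
by [].
Qed.

(** The chain rule for the transition map from [c] to the preferred chart, whose
    Jacobian is [to_pref c]. *)
Lemma velocity_chart c (gam : R -> M) (h : R -> 'rV[R]_m) t :
  atlas c -> I01 R t -> differentiable h t ->
  (\forall s \near t, I01 R s -> cdom c (gam s) /\ coord c (gam s) = h s) ->
  velocity gam t = 'D_1 h t *m to_pref c (coord c (gam t)).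
Proof.
move=> ac It dh gh.
have [ct ht] := nbhs_singleton gh It.
have cit := cimg_coord ct.
pose c' := chart_at (gam t).
have ac' : atlas c' by exact: chart_at_atlas.
have c't : cdom c' (gam t) by exact: chart_at_dom.
have pt := param_coordK ac ct.
have dtr : differentiable (coord c' \o param c) (h t).
  by rewrite -ht; apply: transition_differentiable => //; rewrite pt.
rewrite /velocity (@deriv01E _ ((coord c' \o param c) \o h)) //.
- rewrite deriveE; last exact: differentiable_comp.
  rewrite diff_comp //= -!deriveE // -ht.
  by rewrite -derive_to_pref // pt.
- exact: differentiable_comp.
- apply: filterS gh => s H Is /=; have [cs <-] := H Is.
  by rewrite /= param_coordK.
Qed.

Lemma path_nbhs (phi : R -> M -> M) t x N : smooth_map_path phi ->
  I01 R t -> nbhs (phi t x) N ->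
  \forall p \near (t, x), I01 R p.1 -> N (phi p.1 p.2).
Proof.
move=> sphi It Nphi.
pose c := chart_at x; have ac : atlas c by exact: chart_at_atlas.
have cx : cdom c x by exact: chart_at_dom.
have [/continuous_withinP cphi _] := sphi c ac.
have := cphi (t, coord c x) (conj It (cimg_coord cx)) N.
rewrite /= param_coordK // => /(_ Nphi) [[A B] /= [At Bx] AB].
have [H1 H2] : nbhs t A /\ nbhs x [set y | cdom c y /\ B (coord c y)].
  by split=> //; exact: coord_nbhs.
exists (A, [set y | cdom c y /\ B (coord c y)]) => //= -[s y] /= [As [cy By]] Is.
have := AB (s, coord c y) (conj As By) (conj Is (cimg_coord cy)).
by rewrite /= param_coordK.
Qed.

(** The extension provided by smoothness in time and space, restricted to the
    times at the fixed point [x]. *)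
Lemma path_chart (phi : R -> M -> M) c t x : smooth_map_path phi ->
  I01 R t -> atlas c -> cdom c (phi t x) ->
  exists h : R -> 'rV[R]_m, exists U, [/\ open U, U t, open_smooth U h &
    forall s, U s -> I01 R s -> cdom c (phi s x) /\ coord c (phi s x) = h s].
Proof.
move=> sphi It ac ct.
pose c0 := chart_at x; have ac0 : atlas c0 by exact: chart_at_atlas.
have c0x : cdom c0 x by exact: chart_at_dom.
have px := param_coordK ac0 c0x.
have [_ /(_ c ac) sc] := sphi c0 ac0.
pose z := coord c0 x.
have At : ((I01 R `*` cimg c0) `&`
    (fun p : R * 'rV[R]_m => phi p.1 (param c0 p.2)) @^-1` cdom c) (t, z).
  by split; [split=> //; exact: cimg_coord|rewrite /= px].
have [h [U [oU Ut sh fh]]] := smooth_on_near sc At.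
have dk s : is_diff s (fun s : R => (s, z)) (fun v : R => (v, 0)).
  exact: is_diff_pair (is_diff_id s) (is_diff_cst z s).
have : nbhs t [set s | U (s, z) /\ (I01 R s -> cdom c (phi s x))].
  apply: filterI.
    have : continuous (fun s : R => (s, z)).
      by move=> s; apply: differentiable_continuous; case: (dk s).
    by apply; apply: open_nbhs_nbhs; split.
  have := path_nbhs sphi It (cdom_nbhs ac ct) => -[[A B] /= [At' Bx] AB].
  by apply: filterS At' => s As; apply: (AB (s, x)); split=> //; exact: nbhs_singleton Bx.
rewrite nbhsE => -[V [oV Vt] VU].
exists (fun s => h (s, z)), V; split=> //.
  apply: (open_smooth_comp oV oU (k := fun s => (s, z))) => //.
  - by move=> s /VU [].
  - move=> v; exists 1%N, (fun _ => cst 1), (fun _ => (v, 0)); split=> [_|s _].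
      exact: open_smooth_cst.
    by rewrite big_ord1 scale1r; case: (dk s) => d e; rewrite deriveE // e.
move=> s /VU [Us cs] Is; split; first exact: cs.
rewrite -fh //=; first by rewrite px.
by split; [split=> //; exact: cimg_coord|rewrite /= px; exact: cs].
Qed.

End Charts.

(** * The distance is small on small coordinate balls *)

Lemma smooth_on_bounded {R : realType} (V : normedModType R) (A : set V) (f : V -> R) (x : V) :
  smooth_on A f -> A x -> \forall y \near x, A y -> `|f y| <= `|f x| + 1.
Proof.
move=> sf Ax; have [h [U [oU Ux sh fh]]] := smooth_on_near sf Ax.
have ch : {for x, continuous h}.
  by apply: differentiable_continuous; exact: open_smooth_differentiable sh Ux.
have H1 : \forall y \near x, U y by exact: open_nbhs_nbhs.
have /cvgrPdist_le /(_ _ ltr01) H2 := ch.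
apply: filterS2 H1 H2 => y Uy hy Ay.
rewrite (fh y) // (fh x) // -lerBlDl.
by apply: le_trans hy; rewrite distrC lerB_dist.
Qed.

Section LinearBounds.
Context {R : realType} {m : nat}.

Lemma row_coord_norm (u : 'rV[R]_m) i : `|u 0 i| <= `|u|.
Proof.
rewrite /Num.Def.normr /= mx_normrE.
exact: (le_bigmax _ (fun ij : 'I_1 * 'I_m => `|u ij.1 ij.2|) (0, i)).
Qed.

Lemma linear_row_sum (l : 'rV[R]_m -> R) (u : 'rV[R]_m) :
  (forall b u v, l (b *: u + v) = b * l u + l v) ->
  l u = \sum_i u 0 i * l (delta_mx 0 i).
Proof.
move=> ll.
have l0 : l 0 = 0.
  have := ll 1 0 0; rewrite scale1r addr0 mul1r => /eqP.
  by rewrite -subr_eq0 opprD addNKr oppr_eq0 => /eqP.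
rewrite {1}[u]row_sum_delta.
elim/big_ind2: _ => [//|x1 x2 y1 y2 <- <-|i _].
  by rewrite -[X in l (X + _)]scale1r ll mul1r.
by rewrite -[_ *: _]addr0 ll l0 addr0.
Qed.

Lemma linear_row_bound (l : 'rV[R]_m -> R) (u : 'rV[R]_m) K :
  (forall b u v, l (b *: u + v) = b * l u + l v) ->
  (forall i, `|l (delta_mx 0 i)| <= K) -> `|l u| <= m%:R * (`|u| * K).
Proof.
move=> ll lK; rewrite (linear_row_sum u ll).
apply: le_trans (ler_norm_sum _ _ _) _.
apply: le_trans (_ : \sum_(i < m) `|u| * K <= _); last first.
  by rewrite big_const_ord iter_addr_0 mulr_natl.
apply: ler_sum => i _; rewrite normrM; apply: ler_pM => //.
exact: row_coord_norm.
Qed.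

End LinearBounds.

Section DistanceNbhs.
Context {R : realType} {m : nat} {M : manifold R m}.
Variable g : M -> 'rV[R]_m -> 'rV[R]_m -> R.
Hypothesis gm : is_metric g.

(** In the chart, [g] is a quadratic form whose coefficients are continuous, hence
    bounded near the point. *)
Lemma metric_bounded c x : atlas c -> cdom c x -> exists2 K, 0 <= K &
  \forall z \near coord c x, cimg c z /\ forall u : 'rV[R]_m,
    g (param c z) (u *m to_pref c z) (u *m to_pref c z) <= K * `|u| ^+ 2.
Proof.
move=> ac cx; set z0 := coord c x.
have cz0 : cimg c z0 by exact: cimg_coord.
pose G i j z := g (param c z) (delta_mx 0 i *m to_pref c z) (delta_mx 0 j *m to_pref c z).
pose K := \sum_(i < m) \sum_(j < m) (`|G i j z0| + 1).
have t0 i j : 0 <= `|G i j z0| + 1 by rewrite addr_ge0.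
have K0 : 0 <= K by apply: sumr_ge0 => i _; apply: sumr_ge0.
have GK i j : `|G i j z0| + 1 <= K.
  rewrite /K (bigD1 i) //= (bigD1 j) //= -addrA lerDl addr_ge0 //.
    by apply: sumr_ge0.
  by apply: sumr_ge0 => k _; apply: sumr_ge0.
exists (m%:R * (m%:R * K)); first by rewrite !mulr_ge0.
have H1 : \forall z \near z0, cimg c z.
  by apply: open_nbhs_nbhs; split => //; exact: cimg_open (atlas_chart ac).
have H2 : \forall z \near z0, forall p : 'I_m * 'I_m, `|G p.1 p.2 z| <= K.
  apply: (@filter_forall _ _
    (fun (p : 'I_m * 'I_m) => [set z | `|G p.1 p.2 z| <= K]) _ (nbhs_filter z0)).
  move=> [i j] /=.
  have sG : smooth_on (cimg c) (G i j) by exact: metric_smooth.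
  apply: filterS2 H1 (smooth_on_bounded sG cz0) => z cz /(_ cz) Gz.
  exact: le_trans Gz (GK i j).
apply: filterS2 H1 H2 => z cz Gz; split=> // u.
apply: le_trans (ler_norm _) _.
have lin w : forall (b : R) (u v : 'rV[R]_m), g (param c z) ((b *: u + v) *m to_pref c z) w =
    b * g (param c z) (u *m to_pref c z) w + g (param c z) (v *m to_pref c z) w.
  by move=> b v v'; rewrite mulmxDl -scalemxAl metric_linear.
have B1 j : `|g (param c z) (u *m to_pref c z) (delta_mx 0 j *m to_pref c z)| <= m%:R * (`|u| * K).
  apply: (linear_row_bound _ (lin _)) => i.
  exact: Gz (i, j).
apply: le_trans (_ : _ <= m%:R * (`|u| * (m%:R * (`|u| * K)))) _.
  apply: (linear_row_bound _ (lin _)) => i.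
  by rewrite (metric_sym gm).
by rewrite le_eqVlt; apply/orP; left; apply/eqP; rewrite expr2; ring.
Qed.

Lemma piecewise_length_ge0 (x y : M) l : piecewise_length g x y l -> 0 <= l.
Proof.
elim=> // gam z l' _ _ l0; rewrite addr_ge0 //.
by apply: Rintegral_ge0 => t _; exact: sqrtr_ge0.
Qed.

Lemma distance_le_curve gam : smooth_into (I01 R) gam ->
  distance g (gam 0) (gam 1) <= curve_length g gam.
Proof.
move=> sg; apply: ge_inf.
  by exists 0 => l; exact: piecewise_length_ge0.
by rewrite /= -[X in piecewise_length _ _ _ X]addr0; apply: PiecewiseCons => //; constructor.
Qed.

Lemma curve_length_le gam K : 0 <= K ->
  (forall t, I01 R t -> Num.sqrt (g (gam t) (velocity gam t) (velocity gam t)) <= K) ->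
  curve_length g gam <= K.
Proof.
move=> K0 gK; rewrite /curve_length; set f := fun t => Num.sqrt _.
have mI : measurable (I01 R : set (measurableTypeR R)) by exact: measurable_itv.
have m01 : @lebesgue_measure R (I01 R) = 1%E.
  by rewrite [LHS](lebesgue_measure_itv `[0 : R, 1]) /= lte01 oppr0 adde0.
have H : (\int[lebesgue_measure]_(t in I01 R) (f t)%:E <= K%:E)%E.
  have -> : K%:E = (\int[@lebesgue_measure R]_(t in I01 R) (cst K%:E) t)%E.
    rewrite integral_cst // -[LHS]mule1; congr (_ * _)%E; exact: esym m01.
  rewrite integral_mkcond [leRHS]integral_mkcond.
  apply: ge0_integral_homo => t; rewrite /patch; case: ifP => //.
    by rewrite lee_fin sqrtr_ge0.
  by rewrite inE => It; rewrite lee_fin; exact: gK.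
have H0 : (0 <= \int[@lebesgue_measure R]_(t in I01 R) (f t)%:E)%E.
  by apply: integral_ge0 => t _; rewrite lee_fin sqrtr_ge0.
rewrite /Rintegral -lee_fin fineK //.
by rewrite ge0_fin_numE // (le_lt_trans H) // ltry.
Qed.

Lemma chart_segment_smooth (c : chart R M m) (a v : 'rV[R]_m) : atlas c ->
  (forall t, I01 R t -> cimg c (a + t *: v)) ->
  smooth_into (I01 R) (fun t => param c (a + t *: v)).
Proof.
move=> ac cv.
have dl (t : R) : is_diff t (fun t : R => a + t *: v) (fun s : R => s *: v).
  by apply: is_diff_eq; rewrite add0r.
have lc (t : R) N : nbhs (a + t *: v) N -> \forall s \near t, N (a + s *: v).
  have : continuous (fun t : R => a + t *: v).
    by move=> s; apply: differentiable_continuous; case: (dl s).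
  by move=> /(_ t); apply.
split=> [|c' ac'].
  apply/continuous_withinP => t It N /= Nt.
  have := lc t _ (param_nbhs ac (cv t It) Nt).
  by apply: filterS => s [].
move=> t /= [It c't].
have [h [U [oU Ut sh fh]]] := transition_smooth ac ac' (cv t It) c't.
have : nbhs t [set s : R | U (a + s *: v)] by exact: lc t U (open_nbhs_nbhs (conj oU Ut)).
rewrite nbhsE => -[V [oV Vt] VU].
exists V, (h \o (fun t => a + t *: v)); split=> //.
  apply: (open_smooth_comp oV oU) => //.
  move=> w; exists 1%N, (fun _ => cst 1), (fun _ => w *: v); split=> [_|s _].
    exact: open_smooth_cst.
  by rewrite big_ord1 scale1r; case: (dl s) => d e; rewrite deriveE // e.
by move=> s; rewrite inE => -[[Is cs] /VU /fh [_ _ ->]].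
Qed.

Lemma chart_segment_velocity (c : chart R M m) (a v : 'rV[R]_m) t : atlas c -> I01 R t ->
  (forall t, I01 R t -> cimg c (a + t *: v)) ->
  velocity (fun t => param c (a + t *: v)) t = v *m to_pref c (a + t *: v).
Proof.
move=> ac It cv.
have dl : is_diff t (fun t : R => a + t *: v) (fun s : R => s *: v).
  by apply: is_diff_eq; rewrite add0r.
have [d e] := dl.
pose gam := fun t : R => param c (a + t *: v).
pose l := fun t : R => a + t *: v.
have H : \forall s \near t, I01 R s -> cdom c (gam s) /\ coord c (gam s) = l s.
  by apply: (@filterS _ (nbhs t) _ setT) => [s _ Is|];
    [exact: coord_paramK (cv s Is)|exact: filterT].
rewrite (velocity_chart ac It d H).
have [_ ->] := coord_paramK ac (cv t It).
by rewrite (deriveE _ d) e scale1r.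
Qed.

(** Coordinate balls are convex, and the straight segments in them have length at
    most a multiple of their coordinate length.  With two free points [y] and
    [z], two nearby values of a map can be compared directly. *)
Lemma distance_nbhs (x : M) (e : R) : 0 < e ->
  exists2 N, nbhs x N & forall y z, N y -> N z -> distance g y z <= e.
Proof.
move=> e0.
pose c := chart_at x; have ac : atlas c by exact: chart_at_atlas.
have cx : cdom c x by exact: chart_at_dom.
have [K K0 HK] := metric_bounded ac cx.
have [r /= r0 rK] := (nbhs_ballP _ _).1 HK.
pose S := Num.sqrt K + 1.
have S0 : 0 < S by rewrite ltr_wpDl ?sqrtr_ge0.
pose r' := Num.min r (e / (2 * S)).
have r'0 : 0 < r' by rewrite lt_min r0 divr_gt0 // mulr_gt0.
have H : nbhs (coord c x) (ball (coord c x) r') by exact: nbhsx_ballx.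
exists [set y | cdom c y /\ ball (coord c x) r' (coord c y)]; first exact: coord_nbhs.
move=> y z [cy By] [cz Bz].
pose a := coord c y; pose v := coord c z - coord c y.
have Bv t : I01 R t -> ball (coord c x) r (a + t *: v).
  rewrite /I01 /= in_itv /= => /andP[t0 t1].
  have -> : a + t *: v = (1 - t) *: a + t *: coord c z.
    by rewrite /v scalerBr scalerBl scale1r addrA addrAC.
  have xE : coord c x = (1 - t) *: coord c x + t *: coord c x.
    by rewrite scalerBl scale1r subrK.
  rewrite -ball_normE /= {1}xE opprD addrACA -!scalerBr.
  apply: le_lt_trans (ler_normD _ _) _; rewrite !normrZ.
  rewrite (ger0_norm t0) ger0_norm ?subr_ge0 //.
  move: By Bz; rewrite -ball_normE /= -/a !lt_min => /andP[Ar _] /andP[Br _].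
  set A := `|_| in Ar *; set B := `|_| in Br *.
  have A1 : A <= Num.max A B by rewrite le_max lexx.
  have B1 : B <= Num.max A B by rewrite le_max lexx orbT.
  have C1 : Num.max A B < r by rewrite gt_max Ar Br.
  nra.
have cv t : I01 R t -> cimg c (a + t *: v) by move=> /Bv /rK [].
have -> : y = param c (a + 0 *: v) by rewrite scale0r addr0 param_coordK.
have -> : z = param c (a + 1 *: v) by rewrite scale1r /v addrC subrK param_coordK.
apply: le_trans (distance_le_curve (chart_segment_smooth ac cv)) _.
have ve : `|v| <= e / S.
  rewrite /v -(subrK (coord c x) (coord c z)) -addrA.
  move: By Bz; rewrite -ball_normE /= !lt_min => /andP[_ Ae] /andP[_ Be].
  apply: le_trans (ler_normD _ _) _; rewrite distrC.
  have : e / S = e / (2 * S) + e / (2 * S) by field; rewrite gt_eqF.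
  lra.
apply: curve_length_le; first exact: ltW.
move=> t It; rewrite chart_segment_velocity //.
have [_ /(_ v) gv] := rK _ (Bv t It).
apply: le_trans (_ : Num.sqrt (K * `|v| ^+ 2) <= _).
  by rewrite ler_wsqrtr.
rewrite sqrtrM // sqrtr_sqr normr_id.
apply: le_trans (_ : S * (e / S) <= _); last by rewrite mulrCA mulfV ?gt_eqF // mulr1.
by apply: ler_pM => //; rewrite ?sqrtr_ge0 // lerDl.
Qed.

End DistanceNbhs.

(** * Consequences of compactness *)

Section Compactness.
Context {R : realType} {m : nat} {M : manifold R m}.
Hypothesis Mcompact : compact [set: M].

Lemma time_space_compact : compact (I01 R `*` [set: M]).
Proof. by apply: compact_setX => //; exact: segment_compact. Qed.

Lemma smooth_fun_path_bounded (F : R -> M -> R) : smooth_fun_path F ->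
  exists B, forall t x, I01 R t -> `|F t x| <= B.
Proof.
move=> sF.
have /compact_near_coveringP/near_covering_withinP cov := time_space_compact.
pose P (B : R) (p : R * M) : Prop := `|F p.1 p.2| <= B.
have : \forall B \near +oo, I01 R `*` [set: M] `<=` P B.
  apply: cov => -[t x] /= [It _].
  pose c := chart_at x; have ac : atlas c by exact: chart_at_atlas.
  have cx : cdom c x by exact: chart_at_dom.
  have := smooth_on_bounded (sF c ac) (conj It (cimg_coord cx) : (I01 R `*` cimg c) (t, coord c x)).
  set B0 := _ + 1 => -[[V W] /= [Vt Wx] VW].
  exists (V `*` [set y | cdom c y /\ W (coord c y)], [set B | B0 <= B]).
    split=> /=; last by apply: nbhs_pinfty_ge; exact: num_real.
    exists (V, [set y | cdom c y /\ W (coord c y)]) => //=.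
    by split=> //; exact: coord_nbhs.
  move=> [[s y] B] /= [[Vs [cy Wy]] B0B] [Is _].
  have := VW (s, coord c y) (conj Vs Wy) (conj Is (cimg_coord cy)).
  rewrite /= (param_coordK ac cy) => FB; exact: le_trans FB B0B.
move=> H; have [B HB] := filter_ex H.
by exists B => t x It; apply: (HB (t, x)).
Qed.

Section Isotopy.
Variable Phi : bpath M.
Hypothesis isoPhi : is_isotopy Phi.

(** Joint continuity of the inverse maps, of which only the smoothness at each
    fixed time is part of an isotopy.  Points outside a neighbourhood [Q] of
    [bwd Phi t x] form a compact set that [fwd Phi t] maps away from [x]; by
    compactness, nearby maps keep it away from points near [x]. *)
Lemma isotopy_bwd_nbhs t x N : I01 R t -> nbhs (bwd Phi t x) N ->
  \forall p \near (t, x), I01 R p.1 -> N (bwd Phi p.1 p.2).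
Proof.
move=> It; rewrite nbhsE => -[Q [oQ Qx] QN].
have cQ : compact (~` Q).
  by apply: (subclosed_compact _ Mcompact) => //; exact: open_closedC.
have /compact_near_coveringP/near_covering_withinP cov := cQ.
pose P (p : R * M) (y : M) : Prop := I01 R p.1 -> fwd Phi p.1 y <> p.2.
have : \forall p \near (t, x), ~` Q `<=` P p.
  apply: (cov _ _ P (nbhs_filter (t, x))) => y Qy.
  have yx : fwd Phi t y <> x.
    move=> yx; apply: Qy; move: Qx.
    by rewrite -yx (isotopy_fwdK isoPhi It).
  have := @manifold_hausdorff _ _ M; rewrite open_hausdorff => /(_ _ _ (introN eqP yx)).
  move=> [[A B] /= [+ +] [oA oB /eqP AB]]; rewrite !inE => Ay Bx.
  have := path_nbhs (isotopy_smooth isoPhi) It (open_nbhs_nbhs (conj oA Ay)).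
  move=> -[[V W] /= [Vt Wy] VW].
  exists (W, V `*` B).
    split=> //=; exists (V, B) => //=; split=> //.
    exact: open_nbhs_nbhs.
  move=> [y' [s x']] /= [Wy' [Vs Bx']] _ Is E.
  have := VW (s, y') (conj Vs Wy') Is => /=.
  rewrite E => Ax'.
  by have : (A `&` B) x' by []; rewrite AB.
apply: filterS => -[s y] /= H Is; apply: QN; apply: contrapT => nQ.
by apply: (H _ nQ Is); rewrite (isotopy_bwdK isoPhi Is).
Qed.

End Isotopy.

(** For [t] and [x] given, the values of [G] at nearby times and points lie in one
    neighbourhood of [G t x] of small diameter; compactness makes the range of
    times uniform. *)
Lemma uniform_small (g : M -> 'rV[R]_m -> 'rV[R]_m -> R) (G : R -> M -> M) e :
  is_metric g -> 0 < e ->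
  (forall t x N, I01 R t -> nbhs (G t x) N ->
     \forall p \near (t, x), I01 R p.1 -> N (G p.1 p.2)) ->
  exists2 d : R, 0 < d & forall t s x, I01 R t -> I01 R s -> `|s - t| <= d ->
    distance g (G t x) (G s x) <= e.
Proof.
move=> gm e0 cG.
have /compact_near_coveringP/near_covering_withinP cov := time_space_compact.
pose P (d : R) (p : R * M) : Prop := forall s, I01 R s -> `|s - p.1| <= d ->
  distance g (G p.1 p.2) (G s p.2) <= e.
have : \forall d \near (0 : R)^'+, I01 R `*` [set: M] `<=` P d.
  apply: cov => -[t x] /= [It _].
  have [N Nx dN] := distance_nbhs gm (G t x) e0.
  have [[V W] /= [Vt Wx] VW] := cG t x N It Nx.
  have [r /= r0 rV] := (nbhs_ballP _ _).1 Vt.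
  exists (ball t (r / 2) `*` W, [set d : R | d < r / 2]).
    split=> /=; last by apply: nbhs_right_lt; rewrite divr_gt0.
    exists (ball t (r / 2), W) => //=; split=> //.
    by apply: nbhsx_ballx; rewrite divr_gt0.
  move=> [[s y] d] /= [[Bs Wy] dr] [Is _] s' Is' s'd; apply: dN.
    apply: (VW (s, y)) => //; split=> //=; apply: rV; move: Bs; rewrite -ball_normE /=; lra.
  apply: (VW (s', y)) => //; split=> //=; apply: rV; move: Bs; rewrite -ball_normE /=.
  move=> ts; rewrite -(subrK s t) -addrA; apply: le_lt_trans (ler_normD _ _) _.
  by move: s'd; rewrite /= (distrC s' s); lra.
move=> H.
have [d [d0 Hd]] : exists d : R, 0 < d /\ I01 R `*` [set: M] `<=` P d.
  have : \forall d \near (0 : R)^'+, 0 < d /\ I01 R `*` [set: M] `<=` P d.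
    by apply: filterS2 (nbhs_right_gt 0) H => d d0 Hd; split.
  exact: filter_ex.
by exists d => // t s x It Is st; apply: (Hd (t, x)).
Qed.

End Compactness.

Section CFun.
Context {R : realType} {m : nat} {M : manifold R m}.
Variables (eta : dform M 1) (Phi : bpath M).
Hypotheses (eform : is_form eta) (isoPhi : is_isotopy Phi).

Lemma one_form_linear x b (u v : 'rV[R]_m) : eta x (b *: u + v) = b * eta x u + eta x v.
Proof.
have r' (w w' : 'rV[R]_m) : row' ord0 w = row' ord0 w' by apply/matrixP => -[].
rewrite (@form_multilinear _ _ _ _ _ eform x (b *: u + v) u v ord0 b 1) ?mul1r //.
by rewrite scale1r linearP.
Qed.

Lemma one_form0 x : eta x 0 = 0.
Proof.
have := one_form_linear x 1 0 0; rewrite scale1r addr0 mul1r => /eqP.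
by rewrite -subr_eq0 opprD addNKr oppr_eq0 => /eqP.
Qed.

Lemma one_form_scale x b (u : 'rV[R]_m) : eta x (b *: u) = b * eta x u.
Proof. by rewrite -[b *: u]addr0 one_form_linear one_form0 addr0. Qed.

Lemma C_funE t x : I01 R t ->
  C_fun Phi eta t x = eta (fwd Phi t x) (velocity (fun s => fwd Phi s x) t).
Proof. by move=> It; rewrite /C_fun /isotopy_field (isotopy_fwdK isoPhi It). Qed.

(** In a chart, the velocity of the orbit of [x] and the coefficients of [eta] are
    locally bounded along the compact interval. *)
Lemma C_fun_bounded x : exists B, forall t, I01 R t -> `|C_fun Phi eta t x| <= B.
Proof.
have /compact_near_coveringP/near_covering_withinP cov := @segment_compact R 0 1.
pose P (B : R) (t : R) : Prop := `|C_fun Phi eta t x| <= B.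
have : \forall B \near +oo, I01 R `<=` P B.
  apply: cov => t It.
  pose c := chart_at (fwd Phi t x); have ac : atlas c by exact: chart_at_atlas.
  have cx : cdom c (fwd Phi t x) by exact: chart_at_dom.
  have [h [U [oU Ut sh fh]]] := path_chart (isotopy_smooth isoPhi) It ac cx.
  have [cxt hE] := fh t Ut It.
  have cht : cimg c (h t) by rewrite -hE; exact: cimg_coord.
  pose L z i := local_form eta c z (delta_mx 0 i).
  pose K := \sum_(i < m) (`|L (h t) i| + 1).
  have K0 : 0 <= K by apply: sumr_ge0 => i _; rewrite addr_ge0.
  have LK : \forall z \near h t, forall i, cimg c z -> `|L z i| <= K.
    apply: (@filter_forall _ _
      (fun i => [set z | cimg c z -> `|L z i| <= K]) _ (nbhs_filter (h t))).
    move=> i.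
    apply: filterS (smooth_on_bounded (form_smooth eform ac (delta_mx 0 i)) cht) => z Hz /Hz {}Hz.
    apply: le_trans Hz _; rewrite /K (bigD1 i) //= lerDl.
    by apply: sumr_ge0 => j _; rewrite addr_ge0.
  have ch : {for t, continuous h}.
    by apply: differentiable_continuous; exact: open_smooth_differentiable sh Ut.
  have cDh : {for t, continuous ('D_1 h)}.
    have sDh := open_smooth_derive (1 : R) sh.
    exact: differentiable_continuous (open_smooth_differentiable sDh Ut).
  pose V := `|'D_1 h t| + 1.
  have DV : \forall s \near t, `|'D_1 h s| <= V.
    move/cvgrPdist_le : cDh => /(_ _ ltr01); apply: filterS => s hs.
    by rewrite /V -lerBlDl; apply: le_trans hs; rewrite distrC lerB_dist.
  exists ([set s | U s /\ (forall i, cimg c (h s) -> `|L (h s) i| <= K) /\ `|'D_1 h s| <= V],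
          [set B | m%:R * (V * K) <= B]).
    split=> /=; last by apply: nbhs_pinfty_ge; exact: num_real.
    apply: filterI; first by apply: open_nbhs_nbhs; split.
    by apply: filterI => //; exact: (ch _ LK).
  move=> [s B] /= [[Us [Ls Vs]] KB] Is; rewrite /P /=.
  have [cs hs] := fh s Us Is.
  have gh : \forall u \near s, I01 R u -> cdom c (fwd Phi u x) /\ coord c (fwd Phi u x) = h u.
    by apply: (open_near oU Us) => u Uu Iu; exact: fh.
  have dh := open_smooth_differentiable sh Us.
  rewrite C_funE // (velocity_chart ac Is dh gh) hs.
  rewrite -(param_coordK ac cs) hs.
  have chs : cimg c (h s) by rewrite -hs; exact: cimg_coord.
  apply: le_trans KB.
  have lin (b : R) (u v : 'rV[R]_m) :
      eta (param c (h s)) ((b *: u + v) *m to_pref c (h s)) =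
      b * eta (param c (h s)) (u *m to_pref c (h s)) +
      eta (param c (h s)) (v *m to_pref c (h s)).
    by rewrite mulmxDl -scalemxAl one_form_linear.
  have := linear_row_bound ('D_1 h s) (l := fun v => eta _ (v *m _)) lin (fun i => Ls i chs).
  move=> /le_trans; apply.
  by rewrite ler_wpM2l // ler_wpM2r.
move=> H; have [B HB] := filter_ex H.
by exists B => t It; apply: (HB t).
Qed.

End CFun.

(** * Running an isotopy along another clock *)

Section Reparametrization.
Context {R : realType} {m : nat} {M : manifold R m}.
Variable z : R -> R.
Hypothesis sz : open_smooth setT z.
Hypothesis zI : forall t, I01 R t -> I01 R (z t).

Definition reparam (Phi : bpath M) : bpath M :=
  BPath (fun t => fwd Phi (z t)) (fun t => bwd Phi (z t)).

Lemma time_change_differentiable t : differentiable z t.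
Proof. exact: open_smooth_differentiable sz I. Qed.

Lemma smooth_on_time_change (W W' : normedModType R)
    (A A' : set (R * W)) (f : R * W -> W') :
  (forall p, A' p -> A (z p.1, p.2)) -> smooth_on A f ->
  smooth_on A' (fun p => f (z p.1, p.2)).
Proof.
move=> A'A sf p /A'A Ap; have [U [h [oU Up sh fh]]] := sf _ Ap.
have [oU' sh'] := open_smooth_time_change sz oU sh.
exists ((fun p : R * W => (z p.1, p.2)) @^-1` U).
exists (h \o (fun p : R * W => (z p.1, p.2))); split=> //.
by move=> q; rewrite inE => -[/A'A Aq Uq]; apply: fh; rewrite inE.
Qed.

Lemma reparam_smooth_map_path (phi : R -> M -> M) :
  smooth_map_path phi -> smooth_map_path (fun t => phi (z t)).
Proof.
move=> sphi c ac; have [cphi sc] := sphi c ac; split.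
  apply/continuous_withinP => -[t w] [/= It cw] N /= HN.
  have := (continuous_withinP _ _).1 cphi (z t, w) (conj (zI It) cw) N HN.
  move=> -[[V W] /= [Vt Ww] VW].
  exists (z @^-1` V, W).
    by split=> //=; apply: (differentiable_continuous (time_change_differentiable t)).
  move=> [s w'] /= [Vs Ww'] [/= Is cw'].
  exact: (VW (z s, w') (conj Vs Ww') (conj (zI Is) cw')).
move=> c' ac'.
apply: (@smooth_on_time_change _ _ _ _ _ _ (sc c' ac')).
by move=> [t w] /= [[/= It cw] c'w]; split=> //; split=> //; exact: zI.
Qed.

Lemma reparam_smooth_fun_path (F : R -> M -> R) :
  smooth_fun_path F -> smooth_fun_path (fun t x => 'D_1 z t * F (z t) x).
Proof.
move=> sF c ac.
have A'A (p : R * 'rV[R]_m) : (I01 R `*` cimg c) p -> (I01 R `*` cimg c) (z p.1, p.2).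
  by case: p => t w [/= It cw]; split=> //; exact: zI.
have sF' := smooth_on_time_change A'A (sF c ac).
move=> p Ap; have [U [h [oU Up sh fh]]] := sF' p Ap.
exists U, (fun p => ('D_1 z \o fst) p *: h p); split=> //.
  apply: open_smooth_scale => //; apply: open_smooth_fst => //.
  exact: open_smooth_derive.
by move=> q qU /=; rewrite -fh.
Qed.

Lemma reparam_isotopy (Phi : bpath M) : z 0 = 0 -> is_isotopy Phi -> is_isotopy (reparam Phi).
Proof.
move=> z0 [fK bK sf sb s0]; split=> /=.
- by move=> t It; exact: fK (zI It).
- by move=> t It; exact: bK (zI It).
- exact: reparam_smooth_map_path.
- by move=> t It; exact: sb (zI It).
- by rewrite z0.
Qed.

(** The chain rule in time, in a chart around the point. *)
Lemma reparam_field (Phi : bpath M) t x : is_isotopy Phi -> I01 R t ->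
  isotopy_field (reparam Phi) t x = 'D_1 z t *: isotopy_field Phi (z t) x.
Proof.
move=> isoPhi It; rewrite /isotopy_field /=.
set y := bwd Phi (z t) x.
pose c := chart_at (fwd Phi (z t) y); have ac : atlas c by exact: chart_at_atlas.
have cx : cdom c (fwd Phi (z t) y) by exact: chart_at_dom.
have [h [U [oU Uz sh fh]]] := path_chart (isotopy_smooth isoPhi) (zI It) ac cx.
have dh := open_smooth_differentiable sh Uz.
have dz := time_change_differentiable t.
have dhz : differentiable (h \o z) t by exact: differentiable_comp.
have H1 : \forall s \near z t, I01 R s -> cdom c (fwd Phi s y) /\ coord c (fwd Phi s y) = h s.
  by apply: (open_near oU Uz) => s Us Is; exact: fh.
have H2 : \forall s \near t, I01 R s ->
    cdom c (fwd Phi (z s) y) /\ coord c (fwd Phi (z s) y) = (h \o z) s.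
  have : \forall s \near t, U (z s).
    apply: (differentiable_continuous dz).
    by apply: open_nbhs_nbhs; split.
  by apply: filterS => s Us Is; exact: fh (zI Is).
rewrite (velocity_chart (gam := fun s => fwd Phi s y) ac (zI It) dh H1).
rewrite (velocity_chart (gam := fun s => fwd Phi (z s) y) ac It dhz H2).
rewrite scalemxAl; congr (_ *m _).
rewrite (deriveE _ dhz) (diff_comp dz dh) /= -(deriveE _ dz) (deriveE _ dh).
by rewrite -[X in 'd h (z t) X]mulr1 -[X in 'd h (z t) X]/(_ *: _) linearZ.
Qed.

End Reparametrization.

Section Generating.
Context {R : realType} {m : nat} {M : manifold R m}.
Variables (eta : dform M 1) (omega : dform M 2).
Hypotheses (eform : is_form eta) (oform : is_form omega).

Lemma I_map_scale x (a : R) (X v : 'rV[R]_m) :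
  I_map eta omega x (a *: X) v = a * I_map eta omega x X v.
Proof.
rewrite /I_map.
rewrite one_form_scale //.
pose A (X : 'rV[R]_m) : 'M[R]_(2, m) := col_mx X v.
have rA (Y : 'rV[R]_m) : row ord0 (A Y) = Y.
  apply/rowP => j; rewrite !mxE; case: splitP => // i _.
  by rewrite ord1.
have r'A (Y Y' : 'rV[R]_m) : row' ord0 (A Y) = row' ord0 (A Y').
  apply/matrixP => i j; rewrite !mxE; case: splitP => // k.
  by case: k => -[].
have := @form_multilinear _ _ _ _ _ oform x (A (a *: X)) (A X) (A X) ord0 a 0.
rewrite !rA scale0r addr0 mul0r addr0 => /(_ erefl (r'A _ _) (r'A _ _)).
by rewrite /A => ->; rewrite mulrDr mulrA.
Qed.

Lemma smooth_fun_slice_differentiable (F : R -> M -> R) t c w :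
  smooth_fun_path F -> I01 R t -> atlas c -> cimg c w ->
  differentiable (F t \o param c) w.
Proof.
move=> sF It ac cw.
have [h [U [oU Uw sh fh]]] := smooth_on_near (sF c ac) (conj It cw : (I01 R `*` cimg c) (t, w)).
have dk : is_diff w (fun w : 'rV[R]_m => (t, w)) (fun v : 'rV[R]_m => (0, v)).
  exact: is_diff_pair (is_diff_cst t w) (is_diff_id w).
have [dk1 _] := dk.
have dh := open_smooth_differentiable sh Uw.
apply: near_eq_differentiable (differentiable_comp dk1 dh).
have H1 : \forall w' \near w, cimg c w'.
  by apply: open_nbhs_nbhs; split => //; exact: cimg_open (atlas_chart ac).
have H2 : \forall w' \near w, U (t, w').
  apply: (differentiable_continuous dk1).
  by apply: open_nbhs_nbhs; split.
by apply: filterS2 H1 H2 => w' cw' Uw'; rewrite /= -fh.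
Qed.

Lemma diff_fun_scale (F : R -> M -> R) t a x v : smooth_fun_path F -> I01 R t ->
  diff_fun (fun x => a * F t x) x v = a * diff_fun (F t) x v.
Proof.
move=> sF It; rewrite /diff_fun.
have ac := chart_at_atlas x; have cx := chart_at_dom x.
have d := smooth_fun_slice_differentiable sF It ac (cimg_coord cx).
have -> : (fun x => a * F t x) \o param (chart_at x) = a *: (F t \o param (chart_at x)) by [].
by rewrite deriveZ //; exact: diff_derivable.
Qed.

Variable z : R -> R.
Hypotheses (sz : open_smooth setT z) (zI : forall t, I01 R t -> I01 R (z t)).
Hypothesis z0 : z 0 = 0.

Lemma reparam_coHamiltonian (Phi : bpath M) (F : R -> M -> R) :
  is_coHamiltonian eta omega Phi F ->
  is_coHamiltonian eta omega (reparam z Phi) (fun t x => 'D_1 z t * F (z t) x).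
Proof.
move=> [[isoPhi pull] sF gen]; split.
- split; first exact: reparam_isotopy.
  by move=> t It; exact: pull (zI It).
- exact: reparam_smooth_fun_path.
- move=> t It x v; rewrite reparam_field // I_map_scale gen ?diff_fun_scale //; exact: zI.
Qed.

Lemma reparam_C_fun (Phi : bpath M) t x : is_isotopy Phi -> I01 R t ->
  C_fun (reparam z Phi) eta t x = 'D_1 z t * C_fun Phi eta (z t) x.
Proof.
move=> isoPhi It; rewrite /C_fun reparam_field //=.
exact: one_form_scale.
Qed.

End Generating.

(** * Estimates of the distances *)

Section ConstantValue.
Context {T : Type} {R : realType}.

(** [C_val Phi eta t] is this value for the function [C_fun Phi eta t].  On a
    nonempty type the default 0 makes it homogeneous, and bounded in absolute
    value by each value of [f], whether [f] is constant or not. *)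
Definition const_value (f : T -> R) : R := xget 0 [set a | forall x, f x = a].

Lemma const_valueP (f : T -> R) x : (forall y, f y = f x) -> const_value f = f x.
Proof.
move=> fx.
have H : [set a | forall y, f y = a] (const_value f).
  exact: (xgetPex 0 (ex_intro _ (f x) fx)).
by rewrite -(H x).
Qed.

Lemma const_valueN (f : T -> R) : ~ (exists a, forall y, f y = a) -> const_value f = 0.
Proof. by move=> nf; apply: xgetPN => a fa; apply: nf; exists a. Qed.

Lemma const_value_scale (f h : T -> R) a (x : T) : (forall y, h y = a * f y) ->
  const_value h = a * const_value f.
Proof.
move=> ha; have [[b fb]|nf] := pselect (exists b, forall y, f y = b).
  rewrite (const_valueP (f := f) (x := x)); last by move=> y; rewrite !fb.
  by rewrite -ha; apply: const_valueP => y; rewrite !ha !fb.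
rewrite (const_valueN nf) mulr0; have [a0|a0] := eqVneq a 0.
  by rewrite (const_valueP (x := x)) => [|y]; rewrite !ha a0 !mul0r.
apply: const_valueN => -[b hb]; apply: nf; exists (a^-1 * b) => y.
by rewrite -(hb y) ha mulKf.
Qed.

Lemma const_value_bound (f : T -> R) x : `|const_value f| <= `|f x|.
Proof.
have [[b fb]|nf] := pselect (exists b, forall y, f y = b).
  by rewrite (const_valueP (x := x)) // => y; rewrite !fb.
by rewrite const_valueN // normr0.
Qed.

(** On an empty space every number is a value of every function, so the choice
    made depends on no function. *)
Lemma const_value_empty (f h : T -> R) : ~ (exists x : T, True) -> const_value f = const_value h.
Proof.
move=> nT; congr (xget 0); apply/seteqP; split=> a _ x; exfalso; apply: nT; by exists x.
Qed.

End ConstantValue.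

Section Oscillation.
Context {R : realType} {m : nat} {M : manifold R m}.
Implicit Types u v : M -> R.

Lemma osc_le u K : 0 <= K -> (forall x y, u x - u y <= K) -> osc u <= K.
Proof.
move=> K0 uK; rewrite /osc.
have [[x _]|nM] := pselect (exists x : M, True); last first.
  have -> : range u = set0.
    by rewrite -subset0 => r [x _ _]; apply: nM; exists x.
  by rewrite sup0 /inf image_set0 sup0 oppr0 subrr.
have nr : (range u) !=set0 by exists (u x), x.
have H y : u y - K <= inf (range u).
  apply: lb_le_inf => // _ [w _ <-]; have := uK y w; lra.
rewrite lerBlDr; apply: ge_sup => // _ [w _ <-]; have := H w; lra.
Qed.

Lemma osc_ge u B x y : (forall x, `|u x| <= B) -> u x - u y <= osc u.
Proof.
move=> uB; rewrite /osc.
have H1 : u x <= sup (range u).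
  apply: ub_le_sup; last by exists x.
  by exists B => _ [w _ <-]; apply: le_trans (uB w); exact: ler_norm.
have H2 : inf (range u) <= u y.
  apply: ge_inf; last by exists y.
  by exists (- B) => _ [w _ <-]; have := uB w; rewrite ler_norml => /andP[].
lra.
Qed.

Lemma osc_ge0 u B : (forall x, `|u x| <= B) -> 0 <= osc u.
Proof.
move=> uB.
have [[x _]|nM] := pselect (exists x : M, True).
  by have := osc_ge x x uB; rewrite subrr.
have -> : osc u = 0; last by [].
rewrite /osc; have -> : range u = set0.
  by rewrite -subset0 => r [x _ _]; apply: nM; exists x.
by rewrite /inf image_set0 sup0 oppr0 subrr.
Qed.

End Oscillation.

Section Estimates.
Context {R : realType} {m : nat} {M : manifold R m}.
Variables (eta : dform M 1) (Phi : bpath M) (F : R -> M -> R).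
Hypotheses (eform : is_form eta) (isoPhi : is_isotopy Phi).
Variables (B : R).
Hypothesis FB : forall t x, I01 R t -> `|F t x| <= B.

(** The supremum of this over time is the distance from [Phi] to the identity. *)
Definition size_at t : R :=
  osc (fun x => F t x - 0) + `|C_val Phi eta t - C_val (id_path M) eta t|.

Lemma id_C_fun t x : I01 R t -> C_fun (id_path M) eta t x = 0.
Proof.
move=> It; rewrite /C_fun /isotopy_field /=.
have -> : velocity (fun=> x) t = 0.
  rewrite /velocity (@deriv01E _ _ _ (cst (coord (chart_at x) x))) //.
    by rewrite derive_cst.
  by apply: (@filterS _ (nbhs t) _ setT) => //; exact: filterT.
exact: one_form0.
Qed.

Lemma id_C_val t (x : M) : I01 R t -> C_val (id_path M) eta t = 0.
Proof.
move=> It; rewrite [LHS](const_valueP (f := C_fun (id_path M) eta t) (x := x)).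
  exact: id_C_fun.
by move=> y; rewrite !id_C_fun.
Qed.

(** Only a bounded set is bounded by its supremum; the bound comes from the
    compactness of the interval and of [M]. *)
Lemma size_at_bounded : exists K, forall t, I01 R t -> 0 <= size_at t <= K.
Proof.
have oF t : I01 R t -> 0 <= osc (fun x => F t x - 0) <= `|B| + `|B|.
  move=> It; rewrite (osc_ge0 (B := B)) => [|x]; last by rewrite subr0 FB.
  apply: osc_le => [|x y]; first by rewrite addr_ge0.
  have := FB x It; have := FB y It; rewrite !ler_norml => /andP[a b] /andP[c d].
  by have := ler_norm B; lra.
have [[x _]|nM] := pselect (exists x : M, True).
  have [K HK] := C_fun_bounded eform isoPhi x.
  exists (`|B| + `|B| + K) => t It; rewrite /size_at.
  have /andP[w1 w2] := oF t It.
  rewrite addr_ge0 //= lerD // (id_C_val x It) subr0.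
  by apply: le_trans (HK t It); exact: const_value_bound.
exists (`|B| + `|B|) => t It; rewrite /size_at.
have -> : C_val Phi eta t = C_val (id_path M) eta t by exact: const_value_empty.
by rewrite subrr normr0 addr0; exact: oF.
Qed.

Lemma size_at_le_D_CH t : I01 R t -> size_at t <= D_CH eta Phi F (id_path M) (fun _ _ => 0).
Proof.
move=> It; have [K HK] := size_at_bounded.
apply: ub_le_sup; last by exists t.
by exists K => _ [s Is <-]; have /andP[] := HK s Is.
Qed.

Lemma I010 : I01 R 0.
Proof. by rewrite /I01 /= in_itv /= lexx ler01. Qed.

Lemma D_CH_id_ge0 : 0 <= D_CH eta Phi F (id_path M) (fun _ _ => 0).
Proof.
apply: le_trans (size_at_le_D_CH I010).
by have [K HK] := size_at_bounded; have /andP[] := HK _ I010.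
Qed.

Variables (z : R -> R) (e : R).
Hypotheses (sz : open_smooth setT z) (zI : forall t, I01 R t -> I01 R (z t)).
Hypothesis ze : forall t, 0 <= 'D_1 z t <= 1 + e.
Notation H := (fun t x => 'D_1 z t * F (z t) x).
Notation D := (D_CH eta Phi F (id_path M) (fun _ _ => 0)).

Lemma osc_sub_scale t : I01 R t ->
  osc (fun x => F t x - H t x) <=
  osc (fun x => F t x - 0) + 'D_1 z t * osc (fun x => F (z t) x - 0).
Proof.
move=> It; have /andP[a0 _] := ze t; set a := 'D_1 z t in a0 *.
have b1 x : `|F t x - 0| <= B by rewrite subr0 FB.
have b2 x : `|F (z t) x - 0| <= B by rewrite subr0 FB //; exact: zI.
apply: osc_le => [|x y].
  by rewrite addr_ge0 ?mulr_ge0 // (osc_ge0 (B := B)).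
have o1 := osc_ge x y b1; have o2 := osc_ge y x b2.
have := ler_wpM2l a0 o2; lra.
Qed.

Lemma osc_scale t : I01 R t ->
  osc (fun x => H t x - 0) <= 'D_1 z t * osc (fun x => F (z t) x - 0).
Proof.
move=> It; have /andP[a0 _] := ze t; set a := 'D_1 z t in a0 *.
have b2 x : `|F (z t) x - 0| <= B by rewrite subr0 FB //; exact: zI.
apply: osc_le => [|x y]; first by rewrite mulr_ge0 // (osc_ge0 (B := B)).
have := ler_wpM2l a0 (osc_ge x y b2); lra.
Qed.

Lemma reparam_C_val t : I01 R t ->
  `|C_val Phi eta t - C_val (reparam z Phi) eta t| <=
    `|C_val Phi eta t - C_val (id_path M) eta t| +
    'D_1 z t * `|C_val Phi eta (z t) - C_val (id_path M) eta (z t)| /\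
  `|C_val (reparam z Phi) eta t - C_val (id_path M) eta t| <=
    'D_1 z t * `|C_val Phi eta (z t) - C_val (id_path M) eta (z t)|.
Proof.
move=> It; have /andP[a0 _] := ze t; set a := 'D_1 z t in a0 *.
have [[x _]|nM] := pselect (exists x : M, True); last first.
  have E (Psi : bpath M) s : C_val Psi eta s = C_val (id_path M) eta t.
    exact: const_value_empty.
  by rewrite !(E Phi) !(E (reparam z Phi)) !(E (id_path M)) !subrr !normr0 !mulr0 addr0.
have -> : C_val (reparam z Phi) eta t = a * C_val Phi eta (z t).
  apply: (const_value_scale x) => y; exact: reparam_C_fun.
rewrite !(id_C_val x) //; last exact: zI.
rewrite !subr0 normrM (ger0_norm a0); split=> //.
by apply: le_trans (ler_normB _ _) _; rewrite normrM (ger0_norm a0).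
Qed.

Lemma scaled_size_le t : I01 R t -> 'D_1 z t * size_at (z t) <= (1 + e) * D.
Proof.
move=> It; have /andP[a0 a1] := ze t.
have s1 := size_at_le_D_CH (zI It).
have [K /(_ _ (zI It)) /andP[s0 _]] := size_at_bounded.
exact: ler_pM.
Qed.

(** At time [t] the quantity under the supremum is at most the size of [Phi] at
    [t] plus ['D_1 z t] times its size at [z t]. *)
Lemma D_CH_reparam : D_CH eta Phi F (reparam z Phi) H <= (2 + e) * D.
Proof.
apply: ge_sup; first by eexists; exists 0 => //; exact: I010.
move=> _ [t It <-].
have h1 := osc_sub_scale It; have [h2 _] := reparam_C_val It.
have h3 := size_at_le_D_CH It; have h4 := scaled_size_le It.
apply: le_trans (lerD h1 h2) _; rewrite addrACA -mulrDr.
apply: le_trans (lerD h3 h4) _.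
by rewrite -[X in X + _]mul1r -mulrDl addrA.
Qed.

Lemma D_CH_reparam_id :
  D_CH eta (reparam z Phi) H (id_path M) (fun _ _ => 0) <= (1 + e) * D.
Proof.
apply: ge_sup; first by eexists; exists 0 => //; exact: I010.
move=> _ [t It <-].
have h1 := osc_scale It; have [_ h2] := reparam_C_val It.
have h4 := scaled_size_le It.
by apply: le_trans (lerD h1 h2) _; rewrite -mulrDr.
Qed.

End Estimates.

Lemma dist_bar_le {R : realType} {m : nat} {M : manifold R m}
    (g : M -> 'rV[R]_m -> 'rV[R]_m -> R) (Phi Psi : bpath M) e : 0 <= e ->
  (forall t x, I01 R t -> distance g (fwd Phi t x) (fwd Psi t x) <= e) ->
  (forall t x, I01 R t -> distance g (bwd Phi t x) (bwd Psi t x) <= e) ->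
  dist_bar g Phi Psi <= e.
Proof.
move=> e0 He Hb.
have C0 (f h : M -> M) : (forall x, distance g (f x) (h x) <= e) -> dist_C0 g f h <= e.
  move=> fh; rewrite /dist_C0.
  have [[x _]|nM] := pselect (exists x : M, True).
    apply: ge_sup; first by eexists; exists x.
    by move=> _ [y _ <-].
  set S := (X in sup X); have -> : S = set0; last by rewrite sup0.
  by rewrite -subset0 => r [x _ _]; apply: nM; exists x.
apply: ge_sup; first by eexists; exists 0 => //; exact: I010.
by move=> _ [t It <-]; rewrite ge_max !C0 // => x; [exact: Hb|exact: He].
Qed.

(** * The theorem *)

Theorem lemma3p4 (R : realType) (n : nat) (M : manifold R n.*2.+1)
  (eta : dform M 1) (F : R -> M -> R) :
  compact [set: M] -> connected [set: M] ->
  exists2 C : R, 0 < C &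
  forall (omega : dform M 2) (g : M -> 'rV[R]_(n.*2.+1) -> 'rV[R]_(n.*2.+1) -> R)
    (Phi : bpath M),
  is_cosymplectic eta omega -> is_metric g ->
  is_coHamiltonian eta omega Phi F -> normalized eta omega F ->
  forall eps eps' : R, 0 < eps -> 0 < eps' ->
  exists (Psi : bpath M) (H : R -> M -> R),
    is_coHamiltonian eta omega Psi H /\
    [/\ boundary_flat H,
        normalized eta omega H,
        fwd Psi 0 =1 fwd Phi 0 /\ fwd Psi 1 =1 fwd Phi 1,
        D_CH eta Phi F Psi H
          < 2 * D_CH eta Phi F (id_path M) (fun _ _ => 0) + C * eps &
        D_CH eta Psi H (id_path M) (fun _ _ => 0)
          < 3 * D_CH eta Phi F (id_path M) (fun _ _ => 0) + C * eps /\
        dist_bar g Phi Psi < eps'].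
Proof.
move=> Mc _; exists 1 => // omega g Phi [eform oform _ _ _] gm HPhi Fnorm eps eps' eps0 eps'0.
have [[isoPhi _] sF _] := HPhi.
have [B FB] := smooth_fun_path_bounded Mc sF.
have D0 := D_CH_id_ge0 eform isoPhi FB.
set D := D_CH eta Phi F (id_path M) (fun _ _ => 0) in D0 *.
have e20 : 0 < eps' / 2 by rewrite divr_gt0.
have [d1 d10 Hd1] := uniform_small Mc gm e20
  (fun t x N => path_nbhs (isotopy_smooth isoPhi) (x := x) (N := N) (t := t)).
have [d2 d20 Hd2] := uniform_small Mc gm e20
  (fun t x N => isotopy_bwd_nbhs Mc isoPhi (x := x) (N := N) (t := t)).
(* The first bound makes [e * D < eps]; the others bring the clock within the
   modulus of continuity of the maps and of their inverses. *)
pose e := Num.min (eps / (D + 1)) (Num.min d1 d2).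
have e0 : 0 < e by rewrite !lt_min d10 d20 divr_gt0 // ltr_wpDl.
have eD : e * D < eps.
  have e1 : e <= eps / (D + 1) by rewrite ge_min lexx.
  apply: le_lt_trans (ler_wpM2r D0 e1) _.
  by rewrite mulrAC ltr_pdivrMr ?ltr_wpDl // ltr_pM2l // ltrDl.
have ed1 : e <= d1 by rewrite !ge_min lexx orbT.
have ed2 : e <= d2 by rewrite !ge_min lexx !orbT.
have [z [sz [z0 z1] zt ze [c c01 zc]]] := exists_time_change e0.
have zI t : I01 R t -> I01 R (z t) by move=> /zt [].
exists (reparam z Phi), (fun t x => 'D_1 z t * F (z t) x).
split; first exact: reparam_coHamiltonian.
split.
- by exists c => // t _ tc x; rewrite zc // mul0r.
- move=> t It; rewrite /vol_integral /= form_integral_scale; last by case/andP: (ze t).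
  by have := Fnorm _ (zI t It); rewrite /vol_integral /= => ->; rewrite mulr0.
- by rewrite /= z0 z1.
- apply: le_lt_trans (D_CH_reparam eform isoPhi FB sz zI ze) _.
  by rewrite -/D mul1r; lra.
- split.
    apply: le_lt_trans (D_CH_reparam_id eform isoPhi FB sz zI ze) _.
    by rewrite -/D mul1r; lra.
  apply: le_lt_trans (_ : eps' / 2 < _); last by rewrite ltr_pdivrMr // ltr_pMr // ltr1n.
  apply: dist_bar_le => [|t x It|t x It]; first exact: ltW.
  + have [Iz zte] := zt t It.
    by apply: Hd1 => //; exact: le_trans zte ed1.
  + have [Iz zte] := zt t It.
    by apply: Hd2 => //; exact: le_trans zte ed2.
Qed.
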